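(* Let $K$ be a number field, let $\mathcal{M}_\sim$ be a category of motives over $K$ satisfying Assumptions 1--4 of the context, and let $M\in\mathcal{M}_\sim$ be a homogeneous motive of nonzero weight $n$. Assume that the $l$-adic realizations of $M$ give a family of $l$-adic representations $(\rho_l)_l$ which is strictly compatible in the sense of Serre. Let $\mathrm{P}_{\mathrm{ST}}(M,\psi_\sim):=\mathrm{AST}_K(M)/\widetilde{\mathrm{AST}_K}(M)=\mathrm{ST}_K(M)/\widetilde{\mathrm{ST}_K}(M)$. (a) If $\mathrm{P}_{\mathrm{ST}}(M,\psi_\sim)$ is nontrivial, i.e. $-\mathrm{Id}_V\notin\widetilde{\mathrm{ST}_K}(M)$, then the Sato--Tate Conjecture for $\mathrm{ST}_K(M)$ does not hold. (b) If $\mathrm{P}_{\mathrm{ST}}(M,\psi_\sim)$ is trivial, i.e. $-\mathrm{Id}_V\in\widetilde{\mathrm{ST}_K}(M)$, then the Sato--Tate Conjecture for $\mathrm{ST}_K(M)$ and the Sato--Tate Conjecture for $\widetilde{\mathrm{ST}_K}(M)$ are equivalent.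
   Context: $\mathcal{M}_\sim$ is the category of motives over $K\subset\mathbb{C}$ (Grothendieck's construction, $\mathbb{Q}$-coefficients) for one of: rational, algebraic, smash-nilpotent, homological, numerical equivalence, André's motivated cycles (mot), or Deligne's absolute Hodge cycles (ahc); $h_\sim(X)$ is the motive of a smooth projective $X$, $\mathbf 1$ the unit, $\mathbf 1(-1)=h^2_\sim(\mathbb{P}^1)$ the Lefschetz motive and $\mathbb{T}=\mathbf 1(1)$ its inverse; $\mathcal{M}_{\overline K,\sim}$ is the same category over $\overline K$. Assumption 1: there are orthogonal idempotents $p_r(X)\in\mathrm{End}(h_\sim(X))$ lifting the Künneth components in Betti, étale and de Rham realizations, giving $h_\sim(X)=\bigoplus_{r\ge0}h^r_\sim(X)$. Assumption 2: $\mathcal{M}_\sim$ is Tannakian and semisimple over $\mathbb{Q}$, with Betti realization $H_B$ (factoring through $\mathcal{M}_{\mathrm{ahc}}$, with values in rational Hodge structures) as fiber functor. Assumption 3: for every smooth projective $X$ of dimension $d$ there is a morphism $\ast\colon h^r_\sim(X)\to h^{2d-r}_\sim(X)(d-r)$ whose realizations are the star operators defined by absolute Hodge cycles (Deligne--Milne), so that composing $\mathrm{id}\otimes\ast$ with Poincaré duality gives $\psi^r_\sim\colon h^r_\sim(X)\otimes h^r_\sim(X)\to\mathbf 1(-r)$ whose Betti realization is a polarization. Assumption 4: for objects $M,N$, the Artin motive $\mathrm{Hom}_{\mathcal{M}_{\overline K,\sim}}(\overline M,\overline N)$ is a subobject of the internal $\underline{\mathrm{Hom}}_{\mathcal{M}_\sim}(M,N)$.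 A homogeneous motive $M$ is a direct summand of some $h^r_\sim(X)(m)$; its weight is $n=r-2m$; it carries $\psi_\sim\colon M\otimes M\to\mathbf 1(-n)$, whose Betti realization is a polarization $\psi$ on $V:=H_B(M)$. $\mathrm{GIso}_{(V,\psi)}=\{g\in\mathrm{GL}_V:\psi(gv,gw)=\chi(g)\psi(v,w)\ \forall v,w,\ \text{some }\chi(g)\in\mathbb{G}_m\}$, $\mathrm{Iso}_{(V,\psi)}=\ker\chi$. For an object $N$, $\mathcal{M}_\sim(N)$ is the smallest strictly full Tannakian subcategory containing $N$ and $G_{\mathcal{M}_\sim(N)}:=\mathrm{Aut}^{\otimes}(H_B|\mathcal{M}_\sim(N))$. $\mathrm{AST}_K(M):=G_{\mathcal{M}_\sim(M)}\cap\mathrm{Iso}_{(V,\psi)}$. $G_{\mathcal{M}_\sim(M\oplus\mathbb{T})}\hookrightarrow G_{\mathcal{M}_\sim(M)}\times\mathbb{G}_m$, and $\widetilde{\mathrm{AST}_K}(M)$ is the kernel of its projection to $\mathbb{G}_m$; the first projection embeds it in $\mathrm{AST}_K(M)$ and $\mathrm{AST}_K(M)=\widetilde{\mathrm{AST}_K}(M)\cup-\mathrm{Id}_V\widetilde{\mathrm{AST}_K}(M)$. $\mathrm{ST}_K(M)$, $\widetilde{\mathrm{ST}_K}(M)$ are maximal compact subgroups of $\mathrm{AST}_K(M)(\mathbb{C})$, $\widetilde{\mathrm{AST}_K}(M)(\mathbb{C})$, chosen with $\mathrm{ST}_K(M)=\widetilde{\mathrm{ST}_K}(M)\cup-\mathrm{Id}_V\widetilde{\mathrm{ST}_K}(M)$.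 $\rho_l\colon G_K\to\mathrm{GIso}_{(V_l,\psi_l)}(\mathbb{Q}_l)$ is the $l$-adic realization of $M$ and $\widetilde\rho_l=(\rho_l,\chi_c)\colon G_K\to\mathrm{GL}(V_l\oplus\mathbb{Q}_l(1))$, $\chi_c$ the cyclotomic character; by comparison, $\rho_l$ and $\widetilde\rho_l$ have image in $G_{\mathcal{M}_\sim(M)}(\mathbb{Q}_l)$ and $G_{\mathcal{M}_\sim(M\oplus\mathbb{T})}(\mathbb{Q}_l)$. Sato--Tate Conjecture: fix $l$ and an embedding $\mathbb{Q}_l\subset\mathbb{C}$. For all but finitely many primes $v$ of $\mathcal{O}_K$, with arithmetic Frobenius $\mathrm{Fr}_v$ and residue cardinality $q_v$, let $s_v$ be the semisimple part of $q_v^{n/2}\rho_l(\mathrm{Fr}_v)\in\mathrm{AST}_K(M)(\mathbb{C})$ and $\tilde s_v$ that of $(q_v^{n/2}\mathrm{Id}_{V_l},q_v^{-1}\mathrm{Id}_{\mathbb{Q}_l(1)})\widetilde\rho_l(\mathrm{Fr}_v)\in\widetilde{\mathrm{AST}_K}(M)(\mathbb{C})$. Their eigenvalues have absolute value 1, and they determine conjugacy classes in $\mathrm{ST}_K(M)$ and $\widetilde{\mathrm{ST}_K}(M)$. The Sato--Tate Conjecture for $\mathrm{ST}_K(M)$ (resp. $\widetilde{\mathrm{ST}_K}(M)$) says that the classes of $s_v$ (resp. $\tilde s_v$), ordered by norm, are equidistributed in the space of conjugacy classes with respect to the measure induced by Haar measure. *)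

(* Defs.v *)
From HB Require Import structures.
From mathcomp Require Import all_boot all_order all_algebra all_field.
From mathcomp Require Import finmap mxtens complex.
From mathcomp Require Import all_classical all_reals all_analysis.

Set Implicit Arguments.
Unset Strict Implicit.
Unset Printing Implicit Defensive.

Import Order.TTheory GRing.Theory Num.Theory.
Import numFieldNormedType.Exports.

Local Open Scope classical_set_scope.
Local Open Scope ring_scope.

(* The complex numbers, as a constant so that matrices over them get the
   topology of the normed field structure. *)
Definition CC (R : realType) : numClosedFieldType := R[i].

Definition ofreal (R : realType) (x : R) : CC R := (x%:C)%C.

(** * Rational linear tensor categories *)

Record lincat := LinCat {
  lc_obj :> Type;
  mor : lc_obj -> lc_obj -> lmodType rat;
  idm : forall X, mor X X;
  mcomp : forall X Y Z, mor Y Z -> mor X Y -> mor X Z;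
  compA : forall X Y Z W (h : mor Z W) (g : mor Y Z) (f : mor X Y),
    mcomp h (mcomp g f) = mcomp (mcomp h g) f;
  comp1m : forall X Y (f : mor X Y), mcomp (idm Y) f = f;
  compm1 : forall X Y (f : mor X Y), mcomp f (idm X) = f;
  comp_linl : forall X Y Z (a : rat) (g g' : mor Y Z) (f : mor X Y),
    mcomp (a *: g + g') f = a *: mcomp g f + mcomp g' f;
  comp_linr : forall X Y Z (a : rat) (g : mor Y Z) (f f' : mor X Y),
    mcomp g (a *: f + f') = a *: mcomp g f + mcomp g f' }.

Arguments mor {l}.
Arguments idm {l}.
Arguments mcomp {l X Y Z}.

Reserved Notation "g \oc f" (at level 40, left associativity).
Notation "g \oc f" := (mcomp g f).

Section LinearCategories.
Variable C : lincat.
Implicit Types X Y Z W : C.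

Definition inverse_morphisms X Y (f : mor X Y) (g : mor Y X) : Prop :=
  g \oc f = idm X /\ f \oc g = idm Y.

Definition isomorphic X Y : Prop :=
  exists (f : mor X Y) (g : mor Y X), inverse_morphisms f g.

Definition monic X Y (f : mor X Y) : Prop :=
  forall W (g : mor W X), f \oc g = 0 -> g = 0.

Definition epic X Y (f : mor X Y) : Prop :=
  forall W (g : mor Y W), g \oc f = 0 -> g = 0.

Definition is_kernel W X Y (k : mor W X) (f : mor X Y) : Prop :=
  f \oc k = 0 /\
  forall Z (h : mor Z X), f \oc h = 0 -> exists! u : mor Z W, k \oc u = h.

Definition is_cokernel X Y W (c : mor Y W) (f : mor X Y) : Prop :=
  c \oc f = 0 /\
  forall Z (h : mor Y Z), h \oc f = 0 -> exists! u : mor W Z, u \oc c = h.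

Definition direct_sum S X Y : Prop :=
  exists (i : mor X S) (j : mor Y S) (p : mor S X) (q : mor S Y),
    [/\ p \oc i = idm X, q \oc j = idm Y, q \oc i = 0, p \oc j = 0 &
        i \oc p + j \oc q = idm S].

Definition direct_summand X Y : Prop :=
  exists (i : mor X Y) (p : mor Y X), p \oc i = idm X.

Definition abelian : Prop :=
  [/\ exists Z : C, idm Z = 0,
      forall X Y, exists S, direct_sum S X Y,
      (forall X Y (f : mor X Y), exists W (k : mor W X), is_kernel k f) /\
      (forall X Y (f : mor X Y), exists W (c : mor Y W), is_cokernel c f),
      forall X Y (f : mor X Y), monic f ->
        exists W (g : mor Y W), is_kernel f g &
      forall X Y (f : mor X Y), epic f ->
        exists W (g : mor W X), is_cokernel f g].

Definition semisimple : Prop :=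
  forall X Y (i : mor X Y), monic i -> exists p : mor Y X, p \oc i = idm X.

End LinearCategories.

(* Rigid symmetric monoidal structure. *)
Record tcat := TCat {
  tc_lin :> lincat;
  tens : tc_lin -> tc_lin -> tc_lin;
  tensm : forall X X' Y Y' : tc_lin,
    mor X X' -> mor Y Y' -> mor (tens X Y) (tens X' Y');
  tensm1 : forall X Y, tensm (idm X) (idm Y) = idm (tens X Y);
  tensm_comp : forall X X' X'' Y Y' Y'' (f' : mor X' X'') (f : mor X X')
      (g' : mor Y' Y'') (g : mor Y Y'),
    tensm (f' \oc f) (g' \oc g) = tensm f' g' \oc tensm f g;
  tensm_linl : forall X X' Y Y' (a : rat) (f f' : mor X X') (g : mor Y Y'),
    tensm (a *: f + f') g = a *: tensm f g + tensm f' g;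
  tensm_linr : forall X X' Y Y' (a : rat) (f : mor X X') (g g' : mor Y Y'),
    tensm f (a *: g + g') = a *: tensm f g + tensm f g';
  tone : tc_lin;
  lun : forall X, mor (tens tone X) X;
  lun_inv : forall X, mor X (tens tone X);
  lunK : forall X, inverse_morphisms (lun X) (lun_inv X);
  lun_nat : forall X Y (f : mor X Y),
    lun Y \oc tensm (idm tone) f = f \oc lun X;
  asc : forall X Y Z, mor (tens X (tens Y Z)) (tens (tens X Y) Z);
  asc_inv : forall X Y Z, mor (tens (tens X Y) Z) (tens X (tens Y Z));
  ascK : forall X Y Z, inverse_morphisms (asc X Y Z) (asc_inv X Y Z);
  asc_nat : forall X X' Y Y' Z Z' (f : mor X X') (g : mor Y Y') (h : mor Z Z'),
    asc X' Y' Z' \oc tensm f (tensm g h)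
    = tensm (tensm f g) h \oc asc X Y Z;
  brd : forall X Y, mor (tens X Y) (tens Y X);
  brdK : forall X Y, brd Y X \oc brd X Y = idm (tens X Y);
  brd_nat : forall X X' Y Y' (f : mor X X') (g : mor Y Y'),
    brd X' Y' \oc tensm f g = tensm g f \oc brd X Y;
  pentagon : forall X Y Z W,
    asc (tens X Y) Z W \oc asc X Y (tens Z W)
    = tensm (asc X Y Z) (idm W) \oc asc X (tens Y Z) W
        \oc tensm (idm X) (asc Y Z W);
  triangle : forall X Y,
    tensm (lun X \oc brd X tone) (idm Y) \oc asc X tone Y
    = tensm (idm X) (lun Y);
  hexagon : forall X Y Z,
    asc Z X Y \oc brd (tens X Y) Z \oc asc X Y Z
    = tensm (brd X Z) (idm Y) \oc asc X Z Y \oc tensm (idm X) (brd Y Z);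
  tdual : tc_lin -> tc_lin;
  ev : forall X, mor (tens (tdual X) X) tone;
  coev : forall X, mor tone (tens X (tdual X));
  ev_coev : forall X,
    (lun X \oc brd X tone) \oc tensm (idm X) (ev X)
      \oc asc_inv X (tdual X) X \oc tensm (coev X) (idm X) = lun X;
  coev_ev : forall X,
    lun (tdual X) \oc tensm (ev X) (idm (tdual X))
      \oc asc (tdual X) X (tdual X) \oc tensm (idm (tdual X)) (coev X)
    = lun (tdual X) \oc brd (tdual X) tone }.

Arguments tens {t}.
Arguments tensm {t X X' Y Y'}.
Arguments tone {t}.
Arguments lun {t}.
Arguments asc {t}.
Arguments asc_inv {t}.
Arguments brd {t}.
Arguments tdual {t}.
Arguments ev {t}.
Arguments coev {t}.

Section TensorCategories.
Variable C : tcat.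
Implicit Types X Y N : C.

Definition tens_pow X (k : nat) : C := iter k (tens X) tone.

Definition ihom X Y : C := tens (tdual X) Y.

Definition ihom_ev X Y : mor (tens (ihom X Y) X) Y :=
  (lun Y \oc brd Y tone) \oc tensm (idm Y) (ev X)
    \oc asc_inv Y (tdual X) X \oc tensm (brd (tdual X) Y) (idm X).

Record tannakian_closed (P : C -> Prop) : Prop := TannakianClosed {
  tcl_one : P tone;
  tcl_tens : forall X Y, P X -> P Y -> P (tens X Y);
  tcl_dual : forall X, P X -> P (tdual X);
  tcl_sum : forall S X Y, direct_sum S X Y -> P X -> P Y -> P S;
  tcl_sub : forall X Y (i : mor X Y), monic i -> P Y -> P X;
  tcl_quo : forall X Y (p : mor X Y), epic p -> P X -> P Y }.

(* The (objects of the) smallest strictly full Tannakian subcategory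
   containing N. *)
Definition generated N X : Prop :=
  forall P : C -> Prop, tannakian_closed P -> P N -> P X.

End TensorCategories.

(** * Tensor functors to rational vector spaces *)

Definition tvec (F : fieldType) (d12 d1 d2 : nat)
    (m : 'M[F]_(d12, d1 * d2)) (u : 'cV[F]_d1) (v : 'cV[F]_d2) : 'cV[F]_d12 :=
  m *m (u *t v).

(* A Q-linear symmetric tensor functor to finite-dimensional Q-vector spaces,
   in coordinates: X is sent to the column space Q^(bdim X). The columns of
   bmu X Y are the images of the tensors of basis vectors under the structural
   isomorphism H(X) (x) H(Y) -> H(X (x) Y). *)
Record tfunctor (C : tcat) := TFunctor {
  bdim : C -> nat;
  bmat : forall X Y : C, mor X Y -> 'M[rat]_(bdim Y, bdim X);
  bmat_lin : forall X Y (a : rat) (f g : mor X Y),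
    bmat (a *: f + g) = a *: bmat f + bmat g;
  bmat1 : forall X, bmat (idm X) = 1%:M;
  bmat_comp : forall X Y Z (g : mor Y Z) (f : mor X Y),
    bmat (g \oc f) = bmat g *m bmat f;
  bmu : forall X Y : C, 'M[rat]_(bdim (tens X Y), bdim X * bdim Y);
  bmu_iso : forall X Y, exists m : 'M[rat]_(bdim X * bdim Y, bdim (tens X Y)),
    bmu X Y *m m = 1%:M /\ m *m bmu X Y = 1%:M;
  bmu_nat : forall X X' Y Y' (f : mor X X') (g : mor Y Y'),
    bmat (tensm f g) *m bmu X Y = bmu X' Y' *m (bmat f *t bmat g);
  bmu_asc : forall X Y Z (u : 'cV_(bdim X)) (v : 'cV_(bdim Y))
      (w : 'cV_(bdim Z)),
    bmat (asc X Y Z) *m tvec (bmu X (tens Y Z)) u (tvec (bmu Y Z) v w)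
    = tvec (bmu (tens X Y) Z) (tvec (bmu X Y) u v) w;
  bmu_brd : forall X Y (u : 'cV_(bdim X)) (v : 'cV_(bdim Y)),
    bmat (brd X Y) *m tvec (bmu X Y) u v = tvec (bmu Y X) v u;
  bdim_one : bdim tone = 1%N;
  bone : 'cV[rat]_(bdim tone);
  bone_neq0 : bone != 0;
  bmu_lun : forall X (u : 'cV_(bdim X)),
    bmat (lun X) *m tvec (bmu tone X) bone u = u }.

Arguments bdim {C}.
Arguments bmat {C} t {X Y}.
Arguments bmu {C}.
Arguments bone {C}.

Section FiberFunctors.
Variables (C : tcat) (H : tfunctor C).

Definition faithful_functor : Prop :=
  forall (X Y : C) (f : mor X Y), bmat H f = 0 -> f = 0.

(* Preservation of kernels and cokernels. *)
Definition exact_functor : Prop :=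
  (forall (W X Y : C) (k : mor W X) (f : mor X Y), is_kernel k f ->
     (forall u : 'cV_(bdim H W), bmat H k *m u = 0 -> u = 0) /\
     (forall v : 'cV_(bdim H X), bmat H f *m v = 0 ->
        exists u : 'cV_(bdim H W), bmat H k *m u = v)) /\
  (forall (X Y W : C) (c : mor Y W) (f : mor X Y), is_cokernel c f ->
     (forall w : 'cV_(bdim H W),
        exists v : 'cV_(bdim H Y), bmat H c *m v = w) /\
     (forall v : 'cV_(bdim H Y), bmat H c *m v = 0 ->
        exists u : 'cV_(bdim H X), bmat H f *m u = v)).

Variable F : fieldType.

(* Extension of scalars from Q to F, for F of characteristic 0. *)
Definition bmatF (X Y : C) (f : mor X Y) : 'M[F]_(bdim H Y, bdim H X) :=
  map_mx ratr (bmat H f).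

Definition bmuF (X Y : C) : 'M[F]_(bdim H (tens X Y), bdim H X * bdim H Y) :=
  map_mx ratr (bmu H X Y).

(* The F-points of Aut^(x)(H | P), P being a full tensor subcategory. The values
   of g outside of P are irrelevant. *)
Definition tensor_aut (P : C -> Prop) (g : forall X : C, 'M[F]_(bdim H X)) :
    Prop :=
  [/\ forall X, P X -> g X \in unitmx,
      forall X Y (f : mor X Y), P X -> P Y -> g Y *m bmatF f = bmatF f *m g X,
      forall X Y, P X -> P Y ->
        g (tens X Y) *m bmuF X Y = bmuF X Y *m (g X *t g Y) &
      g tone = 1%:M].

(* The F-points of the group of the subcategory generated by N, in GL(H(N)). *)
Definition mot_group (N : C) : set 'M[F]_(bdim H N) :=
  [set a | exists g, tensor_aut (generated N) g /\ a = g N].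

End FiberFunctors.

Arguments bmatF {C} H F {X Y}.
Arguments bmuF {C}.
Arguments mot_group {C} H F N.

(** * Number fields, l-adic fields, Galois groups, primes *)

(* The field of l-adic numbers, characterised up to unique isomorphism as the
   completion of Q for the l-adic absolute value. *)
Record padicField (R : realType) (l : nat) := PadicField {
  pf_sort :> fieldType;
  pabs : pf_sort -> R;
  pabs_eq0 : forall x, pabs x = 0 <-> x = 0;
  pabsM : forall x y, pabs (x * y) = pabs x * pabs y;
  pabsD : forall x y, pabs (x + y) <= Num.max (pabs x) (pabs y);
  pabs_l : pabs l%:R = l%:R^-1;
  pabs_dense : forall x (e : R), 0 < e -> exists q : rat, pabs (x - ratr q) < e;
  pabs_complete : forall u : nat -> pf_sort,
    (forall e : R, 0 < e -> exists N, forall i j,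
       (N <= i)%N -> (N <= j)%N -> pabs (u i - u j) < e) ->
    exists x, forall e : R, 0 < e -> exists N, forall i,
      (N <= i)%N -> pabs (u i - x) < e }.

Section NumberFields.
(* K is a number field; its algebraic closure is the field algC of algebraic
   numbers, in which K is embedded by iota. *)
Variables (K : fieldExtType rat) (iota : {rmorphism K -> algC}).

Record absGal := AbsGal {
  gal_map :> {rmorphism algC -> algC};
  gal_fix : forall x : K, gal_map (iota x) = iota x }.

Lemma gal_id_fix (x : K) : (idfun : {rmorphism algC -> algC}) (iota x) = iota x.
Proof. by []. Qed.

Definition gal_id : absGal := AbsGal gal_id_fix.

Lemma gal_comp_fix (s t : absGal) (x : K) :
  (s \o t : {rmorphism algC -> algC}) (iota x) = iota x.
Proof. by rewrite /= !gal_fix. Qed.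

Definition gal_comp (s t : absGal) : absGal := AbsGal (gal_comp_fix s t).

(* P is a prime ideal of the subring O of A. *)
Record prime_ideal (A : comNzRingType) (O P : set A) : Prop := PrimeIdeal {
  pi_sub : P `<=` O;
  pi_0 : P 0;
  pi_D : forall x y, P x -> P y -> P (x + y);
  pi_M : forall x y, O x -> P y -> P (x * y);
  pi_1 : ~ P 1;
  pi_prime : forall x y, O x -> O y -> P (x * y) -> P x \/ P y }.

Definition algints : set algC := [set z | z \in Aint].

Definition intK : set K := iota @^-1` algints.

Definition primeK : set (set K) :=
  [set v | prime_ideal intK v /\ exists2 x, v x & x != 0].

Definition residue_card (v : set K) : nat :=
  #|` fset_set [set [set y | intK y /\ v (y - x)] | x in intK]|.

Definition prime_above (v : set K) (P : set algC) : Prop :=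
  prime_ideal algints P /\ forall x, intK x -> (P (iota x) <-> v x).

Definition inertia (v : set K) (s : absGal) : Prop :=
  exists2 P, prime_above v P & forall z, algints z -> P (s z - z).

(* Arithmetic Frobenius elements, for all the primes of algC above v. *)
Definition frobenius (v : set K) (s : absGal) : Prop :=
  exists2 P, prime_above v P &
    forall z, algints z -> P (s z - z ^+ residue_card v).

Definition unramified (F : fieldType) (d : nat) (rho : absGal -> 'M[F]_d)
    (v : set K) : Prop :=
  forall s, inertia v s -> rho s = 1%:M.

Section LadicRepresentations.
Variables (R : realType) (l : nat) (F : padicField R l).

Record ladic_rep (d : nat) (rho : absGal -> 'M[F]_d) : Prop := LadicRep {
  lr_id : rho gal_id = 1%:M;
  lr_comp : forall s t, rho (gal_comp s t) = rho s *m rho t;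
  lr_cont : forall (s : absGal) (e : R), 0 < e -> exists zs : seq algC,
    forall t : absGal, (forall z, z \in zs -> t z = s z) ->
      forall i j, pabs (rho t i j - rho s i j) < e }.

Definition cyclotomic_char (chi : absGal -> F) : Prop :=
  forall (s : absGal) (k : nat), exists a : nat,
    pabs (chi s - a%:R) <= (l%:R ^+ k)^-1 /\
    forall z : algC, z ^+ (l ^ k) = 1 -> s z = z ^+ a.

End LadicRepresentations.

End NumberFields.

Arguments gal_map {K iota}.

(** * Categories of motives

   The record [motives] below is an interface for a category of motives over K:
   smooth projective varieties, their motives and the realization functors are
   given abstractly, together with the properties that relate them. *)

Section Motives.
(* K is embedded in the complex numbers through its algebraic closure. *)
Variables (R : realType) (K : fieldExtType rat) (iota : {rmorphism K -> algC}).
Variable jC : {rmorphism algC -> CC R}.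
Variable Ql : forall l : nat, prime l -> padicField R l.
Arguments Ql {l}.

Definition KtoC (x : K) : CC R := jC (iota x).

(* Enrichment of a tensor functor to rational Hodge structures: hpq p q is the
   projector to the (p, q)-component of the complexification. *)
Record hodge (C : tcat) (H : tfunctor C) := Hodge {
  hpq : forall X : C, int -> int -> 'M[CC R]_(bdim H X);
  hpq_idem : forall X p q, hpq X p q *m hpq X p q = hpq X p q;
  hpq_orth : forall X p q p' q', (p, q) <> (p', q') ->
    hpq X p q *m hpq X p' q' = 0;
  hpq_fin : forall X,
    finite_set [set pq : int * int | hpq X pq.1 pq.2 != 0];
  hpq_sum : forall X,
    \sum_(pq \in [set: int * int]) hpq X pq.1 pq.2 = 1%:M;
  hpq_conj : forall X p q, map_mx Num.conj (hpq X p q) = hpq X q p;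
  hpq_weight : forall X (n : int), exists W : 'M[rat]_(bdim H X),
    map_mx ratr W =
    \sum_(pq \in [set pq : int * int | pq.1 + pq.2 = n]) hpq X pq.1 pq.2;
  hpq_nat : forall X Y (f : mor X Y) p q,
    hpq Y p q *m bmatF H (CC R) f = bmatF H (CC R) f *m hpq X p q;
  hpq_tens : forall X Y p q p' q' (u : 'cV_(bdim H X)) (v : 'cV_(bdim H Y)),
    hpq X p q *m u = u -> hpq Y p' q' *m v = v ->
    hpq (tens X Y) (p + p') (q + q') *m tvec (bmuF H (CC R) X Y) u v
    = tvec (bmuF H (CC R) X Y) u v;
  hpq_one : hpq tone 0 0 = 1%:M }.

Definition weight_proj (C : tcat) (H : tfunctor C) (Hd : hodge H) (X : C)
    (n : int) : 'M[CC R]_(bdim H X) :=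
  \sum_(pq \in [set pq : int * int | pq.1 + pq.2 = n]) hpq Hd X pq.1 pq.2.

(* The projector to the p-th step of the Hodge filtration. *)
Definition fil_proj (C : tcat) (H : tfunctor C) (Hd : hodge H) (X : C)
    (p : int) : 'M[CC R]_(bdim H X) :=
  \sum_(pq \in [set pq : int * int | p <= pq.1]) hpq Hd X pq.1 pq.2.

(* The Weil operator, acting as i^(p-q) on the (p, q)-component. *)
Definition weil_op (C : tcat) (H : tfunctor C) (Hd : hodge H) (X : C) :
    'M[CC R]_(bdim H X) :=
  \sum_(pq \in [set: int * int])
    (Num.imaginary : CC R) ^ (pq.1 - pq.2) *: hpq Hd X pq.1 pq.2.

(* De Rham realization with values in filtered K-vector spaces, in coordinates,
   together with its comparison isomorphism with the Betti realization; its
   functoriality follows from the invertibility of dr_cmp. *)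
Record derham (C : tcat) (H : tfunctor C) (Hd : hodge H) := DeRham {
  dr_mat : forall X Y : C, mor X Y -> 'M[K]_(bdim H Y, bdim H X);
  dr_mu : forall X Y : C, 'M[K]_(bdim H (tens X Y), bdim H X * bdim H Y);
  dr_fil : forall X : C, int -> 'M[K]_(bdim H X);
  dr_cmp : forall X : C, 'M[CC R]_(bdim H X);
  dr_cmp_unit : forall X, dr_cmp X \in unitmx;
  dr_cmp_nat : forall X Y (f : mor X Y),
    dr_cmp Y *m map_mx KtoC (dr_mat f) = bmatF H (CC R) f *m dr_cmp X;
  dr_cmp_tens : forall X Y,
    dr_cmp (tens X Y) *m map_mx KtoC (dr_mu X Y)
    = bmuF H (CC R) X Y *m (dr_cmp X *t dr_cmp Y);
  dr_cmp_fil : forall X p,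
    ((dr_cmp X *m map_mx KtoC (dr_fil X p))^T == (fil_proj Hd X p)^T)%MS }.

(* Etale realizations, transported to Q_l (x) H_B by the comparison
   isomorphisms: a tensor functor to l-adic representations whose underlying
   functor to Q_l-vector spaces is the scalar extension of H_B. *)
Record etale (C : tcat) (H : tfunctor C) := Etale {
  et : forall (l : nat) (pl : prime l) (X : C),
    absGal iota -> 'M[Ql pl]_(bdim H X);
  et_rep : forall l (pl : prime l) X, ladic_rep (@et l pl X);
  et_nat : forall l (pl : prime l) X Y (f : mor X Y) s,
    et pl Y s *m bmatF H (Ql pl) f = bmatF H (Ql pl) f *m et pl X s;
  et_tens : forall l (pl : prime l) X Y s,
    et pl (tens X Y) s *m bmuF H (Ql pl) X Y
    = bmuF H (Ql pl) X Y *m (et pl X s *t et pl Y s);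
  et_one : forall l (pl : prime l) s, et pl tone s = 1%:M;
  et_unram : forall l (pl : prime l) X, exists2 S : set (set K), finite_set S &
    forall v, primeK iota v -> ~ S v -> unramified (@et l pl X) v }.

(* Motives over the algebraic closure, with base change, Galois action on
   morphisms and Betti realization of morphisms. *)
Record geometric_motives (C : tcat) (H : tfunctor C) (E : etale H) :=
  GeometricMotives {
  gm_cat : tcat;
  gm_bc : C -> gm_cat;
  gm_bcm : forall X Y : C, mor X Y -> mor (gm_bc X) (gm_bc Y);
  gm_bcm_lin : forall X Y (a : rat) (f g : mor X Y),
    gm_bcm (a *: f + g) = a *: gm_bcm f + gm_bcm g;
  gm_bcm1 : forall X, gm_bcm (idm X) = idm (gm_bc X);
  gm_bcm_comp : forall X Y Z (g : mor Y Z) (f : mor X Y),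
    gm_bcm (g \oc f) = gm_bcm g \oc gm_bcm f;
  gm_bc_tens : forall X Y,
    isomorphic (gm_bc (tens X Y)) (tens (gm_bc X) (gm_bc Y));
  gm_bc_one : isomorphic (gm_bc tone) tone;
  gm_gal : forall X Y : C,
    absGal iota -> mor (gm_bc X) (gm_bc Y) -> mor (gm_bc X) (gm_bc Y);
  gm_gal_lin : forall X Y s (a : rat) (f g : mor (gm_bc X) (gm_bc Y)),
    gm_gal s (a *: f + g) = a *: gm_gal s f + gm_gal s g;
  gm_gal_comp : forall X Y Z s (g : mor (gm_bc Y) (gm_bc Z))
      (f : mor (gm_bc X) (gm_bc Y)),
    gm_gal s (g \oc f) = gm_gal s g \oc gm_gal s f;
  gm_gal_id : forall X Y (f : mor (gm_bc X) (gm_bc Y)),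
    gm_gal (gal_id iota) f = f;
  gm_galM : forall X Y s t (f : mor (gm_bc X) (gm_bc Y)),
    gm_gal (gal_comp s t) f = gm_gal s (gm_gal t f);
  gm_gal_inv : forall X Y (f : mor (gm_bc X) (gm_bc Y)),
    (forall s, gm_gal s f = f) <-> exists g : mor X Y, f = gm_bcm g;
  gm_betti : forall X Y : C,
    mor (gm_bc X) (gm_bc Y) -> 'M[rat]_(bdim H Y, bdim H X);
  gm_betti_lin : forall X Y (a : rat) (f g : mor (gm_bc X) (gm_bc Y)),
    gm_betti (a *: f + g) = a *: gm_betti f + gm_betti g;
  gm_betti_comp : forall X Y Z (g : mor (gm_bc Y) (gm_bc Z))
      (f : mor (gm_bc X) (gm_bc Y)),
    gm_betti (g \oc f) = gm_betti g *m gm_betti f;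
  gm_betti_bcm : forall X Y (f : mor X Y), gm_betti (gm_bcm f) = bmat H f;
  gm_betti_gal : forall X Y s (f : mor (gm_bc X) (gm_bc Y)) l (pl : prime l),
    map_mx ratr (gm_betti (gm_gal s f)) *m et E pl X s
    = et E pl Y s *m map_mx ratr (gm_betti f) }.

Arguments gm_cat {C H E}.
Arguments gm_bc {C H E}.
Arguments gm_gal {C H E} _ {X Y}.
Arguments gm_betti {C H E} _ {X Y}.

(* 1(m), from the Tate motive T = 1(1) and the Lefschetz motive L = 1(-1). *)
Definition tate_pow (C : tcat) (T L : C) (m : int) : C :=
  match m with Posz k => tens_pow T k | Negz k => tens_pow L k.+1 end.

Record motives := Motives {
  mot_cat :> tcat;
  betti : tfunctor mot_cat;
  mhodge : hodge betti;
  mderham : derham mhodge;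
  metale : etale betti;
  mgeom : geometric_motives metale;
  tate : mot_cat;
  lefschetz : mot_cat;
  tate_lefschetz : isomorphic (tens tate lefschetz) tone;
  tate_hodge : hpq mhodge tate (-1) (-1) = 1%:M;
  tate_etale : forall l (pl : prime l), exists2 chi : absGal iota -> Ql pl,
    cyclotomic_char chi & forall s, et metale pl tate s = (chi s)%:M;
  smproj : Type;
  spdim : smproj -> nat;
  sppoint : smproj;
  spline : smproj;
  spprod : smproj -> smproj -> smproj;
  mot_of : smproj -> mot_cat;
  spdim_point : spdim sppoint = 0%N;
  spdim_line : spdim spline = 1%N;
  spdim_prod : forall X Y, spdim (spprod X Y) = (spdim X + spdim Y)%N;
  mot_of_point : isomorphic (mot_of sppoint) tone;
  mot_of_prod : forall X Y,
    isomorphic (mot_of (spprod X Y)) (tens (mot_of X) (mot_of Y));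
  mot_summand : forall M : mot_cat, exists (X : smproj) (m : int),
    direct_summand M (tens (mot_of X) (tate_pow tate lefschetz m)) }.

Section FixedMotives.
Variable Mo : motives.
Local Notation HB := (betti Mo).
Local Notation C := (CC R).

Definition unit_twist (m : int) : Mo := tate_pow (tate Mo) (lefschetz Mo) m.

Definition twist (X : Mo) (m : int) : Mo := tens X (unit_twist m).

(* The Betti realization of psi is a polarization of weight n: for some
   identification lam of H_B(1(-n)) with Q, the form (x, y) |-> psi(x, C y) is
   symmetric and positive definite on the real points, C being the Weil
   operator. *)
Definition polarization (X : Mo) (n : int)
    (psi : mor (tens X X) (unit_twist (- n))) : Prop :=
  weight_proj (mhodge Mo) X n = 1%:M /\
  exists2 lam : 'rV[rat]_(bdim HB (unit_twist (- n))), lam != 0 &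
    let Q (x y : 'cV[R]_(bdim HB X)) : C :=
      (map_mx ratr lam *m (bmatF HB C psi *m
        tvec (bmuF HB C X X) (map_mx (@ofreal R) x)
          (weil_op (mhodge Mo) X *m map_mx (@ofreal R) y))) 0 0 in
    (forall x y, Q x y = Q y x) /\ (forall x, x != 0 -> 0 < Q x x).

(* Kunneth decomposition, with h^r(X) the image of the idempotent
   kn_inc \oc kn_prj, and Poincare duality. In Betti cohomology
   (hence, through the comparison isomorphisms, in the two others) the r-th Kunneth component is the weight r
   part of the Hodge structure; in etale cohomology it is also the part where
   almost all Frobenius elements have weight r. *)
Record kunneth := Kunneth {
  hr : smproj Mo -> nat -> Mo;
  kn_inc : forall X r, mor (hr X r) (mot_of X);
  kn_prj : forall X r, mor (mot_of X) (hr X r);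
  kn_id : forall X r, kn_prj X r \oc kn_inc X r = idm (hr X r);
  kn_orth : forall X r s, r != s -> kn_prj X s \oc kn_inc X r = 0;
  kn_zero : forall X r, (2 * spdim X < r)%N -> idm (hr X r) = 0;
  kn_sum : forall X,
    \sum_(r < (2 * spdim X).+1) (kn_inc X r \oc kn_prj X r) = idm (mot_of X);
  kn_betti : forall X r,
    bmatF HB C (kn_inc X r \oc kn_prj X r)
    = weight_proj (mhodge Mo) (mot_of X) r%:Z;
  kn_etale : forall X r l (pl : prime l),
    exists2 S : set (set K), finite_set S &
    forall v s, primeK iota v -> ~ S v -> frobenius v s ->
    forall (e : {rmorphism Ql pl -> C}) (a : C),
    eigenvalue (map_mx e (et (metale Mo) pl (hr X r) s)) a ->
    `|a| ^+ 2 * (residue_card iota v)%:R ^+ r = 1;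
  kn_lefschetz : isomorphic (hr (spline Mo) 2) (lefschetz Mo);
  kn_poincare : forall X (r : nat), (r <= 2 * spdim X)%N ->
    mor (tens (hr X r)
           (twist (hr X (2 * spdim X - r)) ((spdim X)%:Z - r%:Z)))
        (unit_twist (- r%:Z));
  kn_poincare_perfect : forall X r (rX : (r <= 2 * spdim X)%N),
    let pairing x y := bmat HB (kn_poincare rX) *m tvec (bmu HB _ _) x y in
    (forall x, (forall y, pairing x y = 0) -> x = 0) /\
    (forall y, (forall x, pairing x y = 0) -> y = 0) }.

Record tannakian_semisimple : Prop := TannakianSemisimple {
  tn_abelian : abelian Mo;
  tn_semisimple : semisimple Mo;
  tn_end_one : forall f : mor (tone : Mo) tone, exists a : rat, f = a *: idm tone;
  tn_faithful : faithful_functor HB;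
  tn_exact : exact_functor HB }.

(* The realizations of star enter only through the polarization obtained from
   it by Poincare duality. *)
Definition star_operators (A1 : kunneth) : Prop :=
  forall X r (rX : (r <= 2 * spdim X)%N),
  exists star : mor (hr A1 X r)
    (twist (hr A1 X (2 * spdim X - r)) ((spdim X)%:Z - r%:Z)),
  polarization
    (kn_poincare A1 rX \oc tensm (idm (hr A1 X r)) star).

Definition artin (A : Mo) : Prop :=
  exists2 X : smproj Mo, spdim X = 0%N & direct_summand A (mot_of X).

(* The Artin motive A corresponding to the Galois module of
   geometric morphisms embeds in the internal Hom, compatibly with H_B. *)
Definition artin_hom : Prop :=
  forall X Y : Mo, let G := mgeom Mo in
  exists (A : Mo) (j : mor A (ihom X Y))
      (phi : mor (gm_bc G X) (gm_bc G Y) -> 'cV[rat]_(bdim HB A)),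
    [/\ artin A, monic j,
        bijective phi /\
        (forall (a : rat) f g, phi (a *: f + g) = a *: phi f + phi g),
        forall l (pl : prime l) s f,
          et (metale Mo) pl A s *m map_mx ratr (phi f)
          = map_mx ratr (phi (gm_gal G s f)) &
        forall f (u : 'cV_(bdim HB X)),
          bmat HB (ihom_ev X Y) *m
            tvec (bmu HB (ihom X Y) X) (bmat HB j *m phi f) u
          = gm_betti G f *m u].

Definition homogeneous (A1 : kunneth) (M : Mo) (n : int) : Prop :=
  exists (X : smproj Mo) (r : nat) (m : int),
    direct_summand M (twist (hr A1 X r) m) /\ n = r%:Z - 2 * m.

(* Strict compatibility in the sense of Serre. *)
Definition strictly_compatible (M : Mo) : Prop :=
  exists2 S : set (set K), finite_set S &
  forall v, primeK iota v -> ~ S v -> exists P : {poly rat},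
  forall l (pl : prime l), ~ v l%:R ->
    unramified (et (metale Mo) pl M) v /\
    forall s, frobenius v s ->
      char_poly (et (metale Mo) pl M s) = map_poly ratr P.

Section SatoTateGroups.
Variables (M MT : Mo) (n : int) (psi : mor (tens M M) (unit_twist (- n))).

Local Notation dM := (bdim HB M).
Local Notation dT := (bdim HB (tate Mo)).

Definition iso_group (F : fieldType) : set 'M[F]_dM :=
  [set g | g \in unitmx /\
    forall x y : 'cV[F]_dM,
      bmatF HB F psi *m tvec (bmuF HB F M M) (g *m x) (g *m y)
      = bmatF HB F psi *m tvec (bmuF HB F M M) x y].

Arguments iso_group F : clear implicits.

Definition AST : set 'M[C]_dM := mot_group HB C M `&` iso_group C.

Definition diag_block (F : fieldType) (a : 'M[F]_dM) (b : 'M[F]_dT) :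
    'M[F]_(dM + dT) := block_mx a 0 0 b.

(* The image of the group of the category generated by MT = M (+) T in
   G_M x G_m, the latter embedded in GL(H_B(M) (+) H_B(T)). *)
Definition mot_groupT (F : fieldType) : set 'M[F]_(dM + dT) :=
  [set a | exists g, tensor_aut (generated MT) g /\
                     a = diag_block (g M) (g (tate Mo))].

Arguments mot_groupT F : clear implicits.

Definition tAST : set 'M[C]_(dM + dT) :=
  [set a | mot_groupT C a /\ drsubmx a = 1%:M].

Definition projV (A : set 'M[C]_(dM + dT)) : set 'M[C]_dM := ulsubmx @` A.

Definition pm_union (A : set 'M[C]_dM) : set 'M[C]_dM :=
  A `|` [set - a | a in A].

End SatoTateGroups.

Definition cosets (d : nat) (A B : set 'M[C]_d) : set (set 'M[C]_d) :=
  [set [set a *m b | b in B] | a in A].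

Definition trivial_quotient (d : nat) (A B : set 'M[C]_d) : Prop :=
  cosets A B = [set B].

Record is_subgroup (d : nat) (H : set 'M[C]_d) : Prop := IsSubgroup {
  sg_unit : forall a, H a -> a \in unitmx;
  sg_1 : H 1%:M;
  sg_M : forall a b, H a -> H b -> H (a *m b);
  sg_V : forall a, H a -> H (invmx a) }.

Definition compact_subgroup (d : nat) (G U : set 'M[C]_d) : Prop :=
  [/\ U `<=` G, is_subgroup U & compact U].

Definition maximal_compact (d : nat) (G U : set 'M[C]_d) : Prop :=
  compact_subgroup G U /\
  forall U', compact_subgroup G U' -> U `<=` U' -> U' = U.

Definition borelM (d : nat) := g_sigma_algebraType (@open 'M[C]_d).

Definition haar (d : nat) (U : set 'M[C]_d) (mu : probability (borelM d) R) :
    Prop :=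
  mu U = 1%E /\
  forall g (A : set (borelM d)), U g -> measurable A -> A `<=` U ->
    mu [set g *m a | a in A] = mu A.

(* Continuous functions on the space of conjugacy classes of U are the same as
   continuous functions on U that are constant on classes. *)
Definition equidistributed (d : nat) (U : set 'M[C]_d) (V : set (set K))
    (x : set K -> 'M[C]_d) : Prop :=
  exists2 mu : probability (borelM d) R, haar U mu &
  forall f : 'M[C]_d -> R, {within U, continuous f} ->
    (forall g h, U g -> U h -> f (g *m h *m invmx g) = f h) ->
    let upto (m : nat) := [set v | V v /\ (residue_card iota v <= m)%N] in
    (fun m : nat => (\sum_(v \in upto m) f (x v)) / #|` fset_set (upto m)|%:R)
      @ \oo --> Rintegral mu U f.

Definition semisimple_part (d : nat) (g s : 'M[C]_d) : Prop :=
  [/\ exists2 P : 'M[C]_d, P \in unitmx & is_diag_mx (P *m s *m invmx P),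
      s *m g = g *m s & exists k, (g - s) ^+ k = 0].

(* fr v is the set of all semisimple parts of the normalised images of the
   Frobenius elements at v; x v represents the conjugacy class in U determined
   by one of them through conjugation in G. *)
Definition sato_tate (d : nat) (G U : set 'M[C]_d)
    (fr : set K -> set 'M[C]_d) (S : set (set K)) : Prop :=
  exists2 x : set K -> 'M[C]_d,
    forall v, primeK iota v -> ~ S v ->
      U (x v) /\
      exists s g, [/\ fr v s, G g & x v = g *m s *m invmx g] &
    equidistributed U (primeK iota `\` S) x.

Section Frobenius.
Variables (M : Mo) (n : int) (l : nat) (pl : prime l).
Variable e : {rmorphism Ql pl -> C}.

Definition qhalf (v : set K) : C :=
  ofreal (Num.sqrt (residue_card iota v)%:R) ^ n.

Definition qinv (v : set K) : C := ((residue_card iota v)%:R)^-1.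

Definition frob_s (v : set K) : set 'M[C]_(bdim HB M) :=
  [set s | exists2 sigma, frobenius v sigma &
     semisimple_part (qhalf v *: map_mx e (et (metale Mo) pl M sigma)) s].

Definition frob_ts (v : set K) : set 'M[C]_(bdim HB M + bdim HB (tate Mo)) :=
  [set s | exists2 sigma, frobenius v sigma &
     semisimple_part
       (diag_block (qhalf v *: map_mx e (et (metale Mo) pl M sigma))
          (qinv v *: map_mx e (et (metale Mo) pl (tate Mo) sigma))) s].

End Frobenius.

End FixedMotives.

End Motives.

Arguments AST {R K iota jC Ql Mo M n} psi.
Arguments tAST {R K iota jC Ql Mo} M MT.
Arguments projV {R K iota jC Ql Mo M} A.
Arguments pm_union {R K iota jC Ql Mo M} A.
Arguments frob_s {R K iota jC Ql Mo} M n {l pl} e.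
Arguments frob_ts {R K iota jC Ql Mo} M n {l pl} e.

(* Main.v *)
Require Import Defs.
From mathcomp Require Import all_boot all_order all_algebra all_field.
From mathcomp Require Import finmap mxtens complex.
From mathcomp Require Import all_classical all_reals all_analysis.
From mathcomp Require Import measurable_realfun ring lra zify.

Import Order.TTheory GRing.Theory Num.Theory.
Import numFieldNormedType.Exports.

Set Implicit Arguments.
Unset Strict Implicit.
Unset Printing Implicit Defensive.

Local Open Scope classical_set_scope.
Local Open Scope ring_scope.

(* The heart of the matter is that normalised Frobenius elements lie in the
   smaller group. Every tensor automorphism of the fibre functor has a semisimple
   part which is again a tensor automorphism, because the Jordan decomposition is
   functorial and compatible with tensor products. Apply this to the product of
   the l-adic action of a Frobenius element at v and of the weight cocharacter
   t |-> (t^n on M, t^-2 on T) at t = sqrt q_v: since the cyclotomic character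
   takes the value q_v there, the product acts trivially on T, and by
   q_v^(n/2) rho_l on M.

   If P_ST is nontrivial, all the classes of the Sato-Tate Conjecture therefore
   lie in a subgroup B of ST with ST = B U -B a disjoint union. The sign character
   of ST/B takes the value 1 on all of them, while its Haar integral is 0. If P_ST
   is trivial, the first projection is a bicontinuous isomorphism from tAST to AST
   which carries every ingredient of one conjecture to the other. *)

(** * Functorial Jordan decomposition *)

(** The motivic groups are known only through families of matrices, one for each object, so a
    semisimple part must be formed on all objects at once and shown to respect morphisms and tensor
    products. Writing it as a polynomial in the matrix makes this possible. The weight cocharacter
    is likewise defined on every object, by t^(p+q) on the Hodge component H^(p,q); evaluating it at
    a square root of q_v covers odd weights. The arithmetic part guards the averages. An infinite
    set of primes of norm at most m would count as empty, and so would a set S exhausting all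
    primes; the average would then be 0 / 0 = 0, the very value of the Haar integral, and the
    contradiction in (a) would be lost. Hence there must be a prime outside S and only finitely many
    of each bounded norm. Zorn's lemma gives the former, linear algebra over Q the latter, with no
    factorisation of ideals. The triviality of the quotient is tested on the algebraic groups and on
    their compact forms; passing from the former to the latter rests on the maximality of tST. *)

Lemma poly_interpolation (F : fieldType) (rs : seq F) (m : nat) :
  uniq rs -> exists q : {poly F},
  forall a, a \in rs -> ('X - a%:P) ^+ m %| q - a%:P.
Proof.
elim: rs => [|a rs IH] /=; first by exists 0.
case/andP=> a_rs /IH[q qP].
pose Rm := \prod_(b <- rs) ('X - b%:P) ^+ m.
have /Bezout_eq1_coprimepP[[u w] /= uwE] : coprimep Rm (('X - a%:P) ^+ m).
  rewrite /Rm big_seq; elim/big_ind: _ => [|p1 p2|b b_rs].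
  - exact: coprime1p.
  - by rewrite coprimepMl => -> ->.
  apply/coprimep_expl/coprimep_expr.
  by rewrite coprimep_XsubC root_XsubC; apply: contraNneq a_rs => ->.
(* By the Bezout relation [u * Rm] is 1 modulo the new modulus and 0 modulo the old ones, so the
   correction changes the residue at [a] only. *)
exists (q + u * Rm * (a%:P - q)) => b; rewrite inE.
have [-> _|_ /= b_rs] := eqVneq b a.
  have -> : q + u * Rm * (a%:P - q) - a%:P =
      w * (q - a%:P) * ('X - a%:P) ^+ m.
    have -> : u * Rm = 1 - w * ('X - a%:P) ^+ m by rewrite -uwE addrK.
    ring.
  exact: dvdp_mulIr.
rewrite addrAC; apply: dvdp_add; first exact: qP.
rewrite -mulrA dvdp_mull // dvdp_mulr // /Rm (big_rem b) //=.
exact: dvdp_mulIl.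
Qed.

Lemma prod_XsubC_dvdp (F : fieldType) (rs : seq F) (p : {poly F}) :
  uniq rs -> (forall a, a \in rs -> root p a) ->
  \prod_(a <- rs) ('X - a%:P) %| p.
Proof.
by move=> urs rsp; apply: uniq_roots_dvdp; [apply/allP|rewrite uniq_rootsE].
Qed.

(** [q] is congruent to a modulo a high power of X - a, for each root a of [P]. So q(A) is killed by
    the product of X - a over the distinct roots and is diagonalizable, while X - q vanishes at all
    these roots and A - q(A) is nilpotent. *)
Lemma jordan_poly (F : closedFieldType) (P : {poly F}) : P != 0 ->
  exists q : {poly F}, forall n (A : 'M[F]_n.+1), horner_mx A P = 0 ->
    diagonalizable (horner_mx A q) /\ exists k, (A - horner_mx A q) ^+ k = 0.
Proof.
move=> P0; have [r rE] := closed_field_poly_normal P.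
pose rs := undup r; pose D : {poly F} := \prod_(a <- rs) ('X - a%:P).
have urs : uniq rs by exact: undup_uniq.
pose m := size r.
have PD : P %| D ^+ m.
  rewrite rE dvdpZl ?lead_coef_eq0 // /m.
  have : {subset r <= rs} by move=> x; rewrite mem_undup.
  elim: (r) => [|a s IH] /= srs; first by rewrite big_nil dvd1p.
  rewrite big_cons exprS dvdp_mul //; last first.
    by apply: IH => x xs; apply: srs; rewrite inE xs orbT.
  rewrite /D (big_rem a) /= ?dvdp_mulIl // srs //; exact: mem_head.
(* [m] bounds the multiplicities of the roots of [P]; the successor lets one factor X - a be split
   off by [exprS]. *)
have [q qP] := poly_interpolation m.+1 urs.
exists q => n A AP.
have ADm : horner_mx A (D ^+ m) = 0.
  by have /dvdpP[w ->] := PD; rewrite rmorphM /= AP mulr0.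
split.
  apply/diagonalizableP; exists rs => //; apply/mxminpoly_min.
  have /dvdpP[w wE] : D ^+ m %| \prod_(a <- rs) (q - a%:P).
    rewrite /D -prodrXl.
    rewrite big_seq [X in _ %| X]big_seq; elim/big_ind2: _ => // [p1 p2 p3 p4|a ars].
      exact: dvdp_mul.
    by apply: dvdp_trans (qP a ars); rewrite exprS dvdp_mull.
  have -> : horner_mx (horner_mx A q) (\prod_(a <- rs) ('X - a%:P)) =
            horner_mx A (\prod_(a <- rs) (q - a%:P)).
    rewrite !rmorph_prod /=.
    by apply: eq_bigr => a _; rewrite !rmorphB /= !horner_mx_C horner_mx_X.
  by rewrite wE rmorphM /= ADm mulr0.
exists m.
have /dvdpP[w wE] : D %| 'X - q.
  apply: prod_XsubC_dvdp => // a ars; rewrite -dvdp_XsubCl.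
  have -> : 'X - q = ('X - a%:P) - (q - a%:P) by ring.
  rewrite dvdp_sub // (dvdp_trans _ (qP a ars)) // exprS dvdp_mulIl //.
have -> : A - horner_mx A q = horner_mx A ('X - q).
  by rewrite rmorphB /= horner_mx_X.
by rewrite -rmorphXn /= wE exprMn rmorphM /= ADm mulr0.
Qed.

Section SemisimplePart.
Variable R : realType.
Local Notation C := (CC R).

Definition diagonal_in_basis d (s : 'M[C]_d) : Prop :=
  exists2 P : 'M[C]_d, P \in unitmx & is_diag_mx (P *m s *m invmx P).

Lemma diagonalizable_in_basis d (s : 'M[C]_d) :
  diagonalizable s <-> diagonal_in_basis s.
Proof.
split=> -[P Pu Ps]; exists P => //.
  by move: Ps; rewrite /similar_to conjumx.
by rewrite /similar_to conjumx.
Qed.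

Lemma nilpotent_sub n (A B : 'M[C]_n) :
  A *m B = B *m A -> (exists k, A ^+ k = 0) -> (exists k, B ^+ k = 0) ->
  exists k, (A - B) ^+ k = 0.
Proof.
move=> AB [k Ak] [m Bm]; exists (k + m)%N.
have cAB : GRing.comm A B by exact: AB.
rewrite exprBn_comm // big1 // => i _.
have [ik|ik] := leqP k (k + m - i)%N.
  by rewrite -(subnK ik) exprD Ak mulr0 mulr0 mul0r mul0rn.
have im : (m <= i)%N by lia.
by rewrite -[X in B ^+ X](subnK im) exprD Bm !mulr0 mul0rn.
Qed.

Lemma conjumx_exp d (P A : 'M[C]_d) k : P \in unitmx ->
  (P *m A *m invmx P) ^+ k = P *m A ^+ k *m invmx P.
Proof.
move=> Pu; elim: k => [|k IH]; first by rewrite !expr0 mulmx1 mulmxV.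
rewrite !exprS IH; change (P *m A *m invmx P *m (P *m A ^+ k *m invmx P) =
  P *m (A *m A ^+ k) *m invmx P).
by rewrite !mulmxA mulmxKV.
Qed.

Lemma diag_mx_exp d (D : 'rV[C]_d) k :
  diag_mx D ^+ k = diag_mx (\row_j D 0 j ^+ k).
Proof.
elim: k => [|k IH].
  by rewrite expr0 -[LHS]/(1%:M) -diag_const_mx; congr diag_mx; apply/rowP=> j; rewrite !mxE.
rewrite exprS IH; change (diag_mx D *m diag_mx (\row_j D 0 j ^+ k) =
  diag_mx (\row_j D 0 j ^+ k.+1)).
by rewrite mulmx_diag; congr diag_mx; apply/rowP=> j; rewrite !mxE exprS.
Qed.

Lemma semisimple_nilpotent d (s : 'M[C]_d) k :
  diagonal_in_basis s -> s ^+ k = 0 -> s = 0.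
Proof.
move=> [P Pu /is_diag_mxP Ps] sk.
pose D := \row_j (P *m s *m invmx P) j j.
have PsE : P *m s *m invmx P = diag_mx D.
  apply/matrixP=> i j; rewrite !mxE.
  by case: eqP => [->|/eqP ij] //; rewrite mulr0n -[RHS](Ps _ _ ij) mxE.
have D0 : D = 0.
  apply/rowP=> j; rewrite [RHS]mxE; apply/eqP.
  have := conjumx_exp s k Pu; rewrite PsE sk mulmx0 mul0mx diag_mx_exp.
  move/matrixP/(_ j j); rewrite [LHS]mxE eqxx mulr1n [LHS]mxE [RHS]mxE.
  by move/eqP; rewrite expf_eq0 => /andP[].
have : P *m s *m invmx P = 0 by rewrite PsE D0 linear0.
move=> /(congr1 (fun X => invmx P *m X *m P)).
by rewrite mulmx0 mul0mx !mulmxA mulVmx // mul1mx mulmxKV.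
Qed.

(** [s] commutes with [A], hence with [t], a polynomial in [A]. The two are diagonalized together,
    and their difference, being also a difference of commuting nilpotent matrices, vanishes. *)
Lemma semisimple_part_horner n (A : 'M[C]_n.+1) (s t : 'M[C]_n.+1) (q : {poly C}) :
  t = horner_mx A q -> semisimple_part A t -> semisimple_part A s -> s = t.
Proof.
move=> tE [Dt tA tk] [Ds sA sk].
have st : comm_mx s t by rewrite tE; apply: comm_mx_horner.
have /codiagonalizableP[P Pu /= /and3P[sP tP _]] :
  {in [:: s; t] &, forall A B, comm_mx A B} /\
  {in [:: s; t], forall A, diagonalizable A}.
  split.
    by move=> X Y; rewrite !inE => /orP[]/eqP-> /orP[]/eqP->.
  move=> X; rewrite !inE => /orP[]/eqP->.
    exact: (proj2 (diagonalizable_in_basis s) Ds).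
  exact: (proj2 (diagonalizable_in_basis t) Dt).
apply/eqP; rewrite -subr_eq0; apply/eqP.
have [k tsk] : exists k, ((A - t) - (A - s)) ^+ k = 0.
  apply: nilpotent_sub => //.
  rewrite !mulmxBl !mulmxBr sA tA st -!addrA; congr (_ + _).
  by rewrite !opprB addrCA [RHS]addrCA; congr (_ + _); rewrite addrC.
apply: (@semisimple_nilpotent _ _ k); last first.
  by rewrite -[RHS]tsk; congr (_ ^+ _); rewrite opprB [RHS]addrC addrA subrK.
exists P => //; rewrite mulmxBr mulmxBl.
move: sP tP; rewrite /similar_to !conjumx // => /is_diag_mxP sP /is_diag_mxP tP.
by apply/is_diag_mxP => i j ij; rewrite [LHS]mxE sP // [X in _ + X]mxE tP // subrr.
Qed.

(* One q serves all the matrices killed by P. Taking for P a common annihilator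
   of two matrices reduces naturality to the case of polynomials in a matrix. *)
Lemma semisimple_part_poly (P : {poly C}) : P != 0 ->
  exists q : {poly C}, forall n (A s : 'M[C]_n.+1), horner_mx A P = 0 ->
  semisimple_part A s <-> s = horner_mx A q.
Proof.
move=> /(@jordan_poly C P)[q qP]; exists q => n A s /qP[Dq kq].
have Aq : semisimple_part A (horner_mx A q).
  split=> //; first exact: (proj1 (diagonalizable_in_basis _) Dq).
  by apply/esym/comm_mx_horner.
by split=> [|->//]; apply: semisimple_part_horner Aq.
Qed.

Lemma semisimple_part_natural d1 d2 (A s : 'M[C]_d1) (B t : 'M[C]_d2)
    (f : 'M[C]_(d1, d2)) :
  semisimple_part A s -> semisimple_part B t ->
  A *m f = f *m B -> s *m f = f *m t.
Proof.
(* Evaluation of polynomials at a matrix requires positive size, so empty matrices are set apart. *)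
case: d1 A s f => [|d1] A s f; first by move=> *; apply/matrixP => -[].
case: d2 B t f => [|d2] B t f; first by move=> *; apply/matrixP => i -[].
move=> As Bt Af.
have [q qP] := @semisimple_part_poly (char_poly A * char_poly B)
  (mulf_neq0 (monic_neq0 (char_poly_monic A)) (monic_neq0 (char_poly_monic B))).
have -> : s = horner_mx A q.
  by apply: (proj1 (qP _ A s _) As); rewrite rmorphM /= Cayley_Hamilton mul0r.
have -> : t = horner_mx B q.
  by apply: (proj1 (qP _ B t _) Bt); rewrite rmorphM /= Cayley_Hamilton mulr0.
elim/poly_ind: q {qP} => [|q c IH]; first by rewrite !rmorph0 mul0mx mulmx0.
rewrite !rmorphD !rmorphM /= !horner_mx_X !horner_mx_C.
rewrite mulmxDl mulmxDr -!mulmxE -!mulmxA Af !mulmxA IH.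
by rewrite mul_scalar_mx mul_mx_scalar.
Qed.

Lemma semisimple_part_unique d (A s t : 'M[C]_d) :
  semisimple_part A s -> semisimple_part A t -> s = t.
Proof.
by move=> As At; rewrite -[s]mulmx1 -[t]mul1mx; apply: semisimple_part_natural As At _;
  rewrite mulmx1 mul1mx.
Qed.

Lemma semisimple_part_exists d (A : 'M[C]_d) : exists s, semisimple_part A s.
Proof.
case: d A => [|d] A.
  exists A; split=> //; last by exists 1%N; apply/matrixP => -[].
  by exists 1%:M; [exact: unitmx1 | apply/is_diag_mxP => -[]].
have [q qP] := semisimple_part_poly (monic_neq0 (char_poly_monic A)).
by exists (horner_mx A q); apply: (proj2 (qP _ A _ _)) => //; exact: Cayley_Hamilton.
Qed.

Lemma semisimple_part_scalar d (a : C) : semisimple_part (a%:M : 'M[C]_d) a%:M.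
Proof.
split=> //; last by exists 1%N; rewrite subrr expr0n.
exists 1%:M; first exact: unitmx1.
by rewrite mul1mx invmx1 mulmx1 scalar_mx_is_diag.
Qed.

(** When (A - s)^k = 0, the unit A^k equals A^k - (A - s)^k, which has the factor A - (A - s) =
    s. *)
Lemma semisimple_part_unit d (A s : 'M[C]_d) :
  semisimple_part A s -> A \in unitmx -> s \in unitmx.
Proof.
case: d A s => [|d] A s [_ sA [k Ask]] Au.
  by rewrite unitmxE det_mx00 unitr1.
have := @subrXX_comm _ A (A - s) k.
rewrite Ask subr0 subKr => H.
have : A ^+ k \is a GRing.unit by apply: unitrX.
rewrite H; last by rewrite /GRing.comm mulrBl mulrBr; congr (_ - _); rewrite -!mulmxE sA.
set w := (X in s * X); change (s *m w \in unitmx -> s \in unitmx).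
by rewrite unitmx_mul => /andP[].
Qed.

End SemisimplePart.
Lemma invmx_uniq (F : fieldType) d (X Y : 'M[F]_d) : X *m Y = 1%:M -> invmx X = Y.
Proof.
by move=> XY; have [Xu _] := mulmx1_unit XY; rewrite -[LHS]mulmx1 -XY mulKmx.
Qed.

(** * Kronecker products and block-diagonal matrices *)

Section TensorBlock.
Variable F : fieldType.

Lemma tensmxBl m n p q (A B : 'M[F]_(m, n)) (D : 'M[F]_(p, q)) :
  (A - B) *t D = A *t D - B *t D.
Proof. by apply/matrixP=> i j; rewrite !mxE mulrBl. Qed.

Lemma tensmxBr m n p q (A B : 'M[F]_(m, n)) (D : 'M[F]_(p, q)) :
  D *t (A - B) = D *t A - D *t B.
Proof. by apply/matrixP=> i j; rewrite !mxE mulrBr. Qed.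

Lemma tensmx1 m n : (1%:M : 'M[F]_m) *t (1%:M : 'M[F]_n) = 1%:M.
Proof.
apply/matrixP=> i j.
rewrite -(mxtens_unindexK i) -(mxtens_unindexK j).
case: (mxtens_unindex i) (mxtens_unindex j) => [a b] [c e].
rewrite tensmxE !mxE (can_eq (@mxtens_indexK m n)).
by rewrite xpair_eqE -mulnb natrM.
Qed.

Lemma tensmx_exp m n (A : 'M[F]_m) (B : 'M[F]_n) k :
  (A *t B) ^+ k = (A ^+ k) *t (B ^+ k).
Proof.
elim: k => [|k IH]; first by rewrite !expr0 [RHS]tensmx1.
by rewrite !exprS IH; apply: (tensmx_mul A B (A ^+ k) (B ^+ k)).
Qed.

Lemma is_diag_tensmx m n (A : 'M[F]_m) (B : 'M[F]_n) :
  is_diag_mx A -> is_diag_mx B -> is_diag_mx (A *t B).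
Proof.
move=> /is_diag_mxP Ad /is_diag_mxP Bd; apply/is_diag_mxP => i j ij.
have : mxtens_unindex i != mxtens_unindex j.
  by rewrite (can_eq (@mxtens_unindexK m n)).
rewrite -(mxtens_unindexK i) -(mxtens_unindexK j) !mxtens_indexK.
case: (mxtens_unindex i) (mxtens_unindex j) => [a b] [c e]; rewrite tensmxE.
rewrite xpair_eqE negb_and => /orP[ac|be]; first by rewrite (Ad _ _ ac) mul0r.
by rewrite (Bd _ _ be) mulr0.
Qed.

Lemma block_diag_mul m n (A B : 'M[F]_m) (D E : 'M[F]_n) :
  block_mx A 0 0 D *m block_mx B 0 0 E = block_mx (A *m B) 0 0 (D *m E).
Proof. by rewrite mulmx_block !mulmx0 !mul0mx !addr0 add0r. Qed.

Lemma block_diag1 m n :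
  block_mx (1%:M : 'M[F]_m) 0 0 (1%:M : 'M[F]_n) = 1%:M.
Proof. by rewrite [RHS]scalar_mx_block. Qed.

Lemma block_diag_exp m n (A : 'M[F]_m) (D : 'M[F]_n) k :
  block_mx A 0 0 D ^+ k = block_mx (A ^+ k) 0 0 (D ^+ k).
Proof.
elim: k => [|k IH]; first by rewrite !expr0; apply/esym/block_diag1.
by rewrite !exprS IH; apply: (block_diag_mul A (A ^+ k) D (D ^+ k)).
Qed.

Lemma is_diag_block m n (A : 'M[F]_m) (D : 'M[F]_n) :
  is_diag_mx A -> is_diag_mx D -> is_diag_mx (block_mx A 0 0 D).
Proof.
move=> /is_diag_mxP Ad /is_diag_mxP Dd; apply/is_diag_mxP => i j.
case: (split_ordP i) => i' ->; case: (split_ordP j) => j' ->.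
- by move=> ij; rewrite block_mxEul Ad //; apply: contra ij => /eqP/val_inj ->.
- by rewrite block_mxEur mxE.
- by rewrite block_mxEdl mxE.
- by move=> ij; rewrite block_mxEdr Dd //; apply: contra ij => /eqP/val_inj ->.
Qed.
End TensorBlock.

Section SemisimpleTensor.
Variable R : realType.
Local Notation C := (CC R).

Lemma semisimple_part_tens m n (A s : 'M[C]_m) (B t : 'M[C]_n) :
  semisimple_part A s -> semisimple_part B t ->
  semisimple_part (A *t B) (s *t t).
Proof.
move=> [[P Pu Ps] sA [k ks]] [[Q Qu Qt] tB [k' kt]]; split.
- exists (P *t Q).
    by have [] := @mulmx1_unit _ _ (P *t Q) (invmx P *t invmx Q);
      rewrite // tensmx_mul !mulmxV // tensmx1.
  rewrite (@invmx_uniq _ _ (P *t Q) (invmx P *t invmx Q)); last first.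
    by rewrite tensmx_mul !mulmxV // tensmx1.
  by rewrite !tensmx_mul; apply: is_diag_tensmx.
- by rewrite !tensmx_mul sA tB.
(* Both terms on the right are nilpotent, each through one of its tensor factors, and they
   commute. *)
have -> : A *t B - s *t t = (A - s) *t B - s *t (t - B).
  by rewrite tensmxBl tensmxBr opprB addrA subrK.
apply: nilpotent_sub.
- rewrite !tensmx_mul; congr tensmx; first by rewrite mulmxBl mulmxBr sA.
  by rewrite mulmxBl mulmxBr tB.
- by exists k; rewrite tensmx_exp ks tens0mx.
- by exists k'; rewrite tensmx_exp -[t - B]opprB exprNn kt mulr0 tensmx0.
Qed.

Lemma semisimple_part_block m n (A s : 'M[C]_m) (B t : 'M[C]_n) :
  semisimple_part A s -> semisimple_part B t ->
  semisimple_part (block_mx A 0 0 B) (block_mx s 0 0 t).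
Proof.
move=> [[P Pu Ps] sA [k ks]] [[Q Qu Qt] tB [k' kt]].
have PQ : block_mx P 0 0 Q *m block_mx (invmx P) 0 0 (invmx Q) = 1%:M.
  by rewrite block_diag_mul !mulmxV // block_diag1.
split.
- exists (block_mx P 0 0 Q); first by have [] := mulmx1_unit PQ.
  rewrite (invmx_uniq PQ) !block_diag_mul; exact: is_diag_block.
- by rewrite !block_diag_mul sA tB.
exists (k + k')%N; rewrite opp_block_mx add_block_mx !oppr0 !addr0 block_diag_exp.
by rewrite !exprD ks kt mul0r mulr0 block_mx0.
Qed.

(** The semisimple parts of [A] and [B] form a semisimple part of the block matrix; uniqueness does
    the rest, without looking at the diagonalizing basis. *)
Lemma semisimple_part_block_inv m n (A s : 'M[C]_m) (B t : 'M[C]_n) :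
  semisimple_part (block_mx A 0 0 B) (block_mx s 0 0 t) -> semisimple_part A s.
Proof.
have [s' As'] := semisimple_part_exists A; have [t' Bt'] := semisimple_part_exists B.
move=> /(semisimple_part_unique (semisimple_part_block As' Bt')).
by move=> /eq_block_mx[<-].
Qed.
End SemisimpleTensor.
(** * Tensor automorphisms *)

Section TensorAutomorphisms.
Variables (C : tcat) (H : tfunctor C).

Lemma tensor_autM (F : fieldType) (P : C -> Prop)
    (g h : forall X : C, 'M[F]_(bdim H X)) :
  tensor_aut P g -> tensor_aut P h -> tensor_aut P (fun X => g X *m h X).
Proof.
move=> [gu gn gt g1] [hu hn ht h1]; split.
- by move=> X PX; rewrite unitmx_mul gu ?hu.
- by move=> X Y f PX PY; rewrite -mulmxA hn // mulmxA gn // mulmxA.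
- by move=> X Y PX PY; rewrite -mulmxA ht // mulmxA gt // -mulmxA tensmx_mul.
- by rewrite g1 h1 mulmx1.
Qed.

Lemma tensor_autV (F : fieldType) (P : C -> Prop)
    (g : forall X : C, 'M[F]_(bdim H X)) :
  P tone -> (forall X Y, P X -> P Y -> P (tens X Y)) ->
  tensor_aut P g -> tensor_aut P (fun X => invmx (g X)).
Proof.
move=> P1 PM [gu gn gt g1]; split.
- by move=> X PX; rewrite unitmx_inv gu.
- move=> X Y f PX PY; apply: (canRL (mulmxK (gu _ PX))).
  by rewrite -mulmxA -gn // mulKmx // gu.
- move=> X Y PX PY.
  have XYu : g X *t g Y *m (invmx (g X) *t invmx (g Y)) = 1%:M.
    by rewrite tensmx_mul !mulmxV ?gu // tensmx1.
  rewrite -[LHS]mulmx1 -XYu mulmxA -[X in X *m (_ *t _) = _]mulmxA -gt //.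
  by rewrite mulKmx // gu //; apply: PM.
- by rewrite g1 invmx1.
Qed.

Lemma tensor_aut_map (F F' : fieldType) (e : {rmorphism F -> F'})
    (P : C -> Prop) (g : forall X : C, 'M[F]_(bdim H X)) :
  tensor_aut P g -> tensor_aut P (fun X => map_mx e (g X)).
Proof.
have eQ m n (A : 'M[rat]_(m, n)) : map_mx e (map_mx ratr A) = map_mx ratr A.
  by apply/matrixP=> i j; rewrite !mxE fmorph_rat.
move=> [gu gn gt g1]; split.
- by move=> X PX; rewrite map_unitmx gu.
- move=> X Y f PX PY; rewrite /bmatF -eQ -!map_mxM -/(bmatF H F f).
  by rewrite gn.
- move=> X Y PX PY; rewrite /bmuF -eQ -map_mxT -!map_mxM -/(bmuF H F X Y).
  by rewrite gt.
- by rewrite g1 map_mx1.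
Qed.

Variable R : realType.

(** Naturality and compatibility with tensor products are both intertwining relations, along [bmatF]
    and [bmuF] respectively, and [semisimple_part_natural] transfers such relations to semisimple
    parts. *)
Lemma tensor_aut_semisimple (P : C -> Prop)
    (g s : forall X : C, 'M[CC R]_(bdim H X)) :
  P tone -> (forall X Y, P X -> P Y -> P (tens X Y)) ->
  tensor_aut P g -> (forall X, P X -> semisimple_part (g X) (s X)) ->
  tensor_aut P s.
Proof.
move=> P1 PM [gu gn gt g1] gs; split.
- by move=> X PX; apply: semisimple_part_unit (gs _ PX) (gu _ PX).
- move=> X Y f PX PY; apply: semisimple_part_natural (gs _ PY) (gs _ PX) _.
  exact: gn.
- move=> X Y PX PY; apply: semisimple_part_natural (gs _ (PM _ _ PX PY)) _ (gt _ _ PX PY).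
  by apply: semisimple_part_tens; apply: gs.
- apply: semisimple_part_unique (gs _ P1) _; rewrite g1.
  exact: semisimple_part_scalar.
Qed.

End TensorAutomorphisms.

Lemma delta_tensmx (F : fieldType) a b (k : 'I_a) (l : 'I_b) :
  (delta_mx k 0 : 'cV[F]_a) *t (delta_mx l 0 : 'cV[F]_b) =
  delta_mx (mxtens_index (k, l)) 0.
Proof.
apply/matrixP=> i j; rewrite -(mxtens_unindexK i).
case: (mxtens_unindex i) => k' l'.
rewrite -(@mxtens_unindexK 1 1 j).
case: (mxtens_unindex j) => o o'; rewrite tensmxE !mxE.
rewrite (can_eq (@mxtens_indexK a b)) xpair_eqE !(ord1 o, ord1 o') !eqxx !andbT.
by rewrite -natrM mulnb.
Qed.

Lemma tensmx_ext (F : fieldType) m a b (A B : 'M[F]_(m, a * b)) :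
  (forall (u : 'cV_a) (v : 'cV_b), A *m (u *t v) = B *m (u *t v)) -> A = B.
Proof.
move=> AB; apply/matrixP => i j; rewrite -(mxtens_unindexK j).
case: (mxtens_unindex j) => k l.
have := AB (delta_mx k 0) (delta_mx l 0); rewrite delta_tensmx.
by rewrite -!colE => /matrixP/(_ i 0); rewrite !mxE.
Qed.

(** * The weight cocharacter of the Hodge structures *)

Section WeightCocharacter.
Variables (R : realType) (C : tcat) (H : tfunctor C) (Hd : hodge R H).
Variables (t : CC R) (t_neq0 : t != 0).

Definition hodge_supp (X : C) : {fset int * int} :=
  fset_set [set pq : int * int | hpq Hd X pq.1 pq.2 != 0].

Definition weight_cochar (X : C) : 'M[CC R]_(bdim H X) :=
  \sum_(i <- hodge_supp X) t ^ (i.1 + i.2) *: hpq Hd X i.1 i.2.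

Lemma hpq_supp X i : i \notin hodge_supp X -> hpq Hd X i.1 i.2 = 0.
Proof.
rewrite /hodge_supp in_fset_set; last exact: hpq_fin.
by move/negP => iS; apply: contra_notP iS => /eqP iS; apply/mem_set.
Qed.

Lemma hpq_supp_sum X : \sum_(i <- hodge_supp X) hpq Hd X i.1 i.2 = 1%:M.
Proof. by rewrite -(hpq_sum Hd X) (fsbigTE (hodge_supp X)) // => i /hpq_supp. Qed.

Lemma weight_cochar_hpq X i :
  weight_cochar X *m hpq Hd X i.1 i.2 = t ^ (i.1 + i.2) *: hpq Hd X i.1 i.2.
Proof.
rewrite -[hpq Hd X i.1 i.2 in RHS]mul1mx -hpq_supp_sum !mulmx_suml scaler_sumr.
apply: eq_bigr => j _; rewrite -scalemxAl.
have [->//|ji] := eqVneq j i.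
rewrite hpq_orth ?scaler0 //; apply/eqP; apply: contra ji => /eqP[j1 j2].
by rewrite -pair_eqE /pair_eq /= j1 j2 !eqxx.
Qed.

Lemma weight_cochar_eq X p q : hpq Hd X p q = 1%:M ->
  weight_cochar X = (t ^ (p + q))%:M.
Proof.
move=> h1; rewrite -[LHS]mulmx1 -h1 (weight_cochar_hpq X (p, q)) /= h1.
by rewrite scalemx1.
Qed.

Lemma weight_proj_supp X n : weight_proj Hd X n =
  \sum_(i <- hodge_supp X | i.1 + i.2 == n) hpq Hd X i.1 i.2.
Proof.
rewrite /weight_proj fsbig_mkcond (fsbigTE (hodge_supp X)); last first.
  by move=> i /hpq_supp; rewrite /patch => ->; case: ifP.
rewrite [RHS]big_mkcond; apply: eq_bigr => i _; rewrite /patch.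
have [in_n|ni] := eqVneq (i.1 + i.2) n; first by rewrite mem_set.
by rewrite memNset //; apply/eqP.
Qed.

Lemma weight_cochar_pure X n : weight_proj Hd X n = 1%:M ->
  weight_cochar X = (t ^ n)%:M.
Proof.
move=> Wn; rewrite -scalemx1 -[LHS]mulmx1 -Wn weight_proj_supp.
rewrite mulmx_sumr scaler_sumr; apply: eq_bigr => i /eqP <-.
exact: weight_cochar_hpq.
Qed.

Lemma weight_cochar_nat X Y (f : mor X Y) :
  weight_cochar Y *m bmatF H (CC R) f = bmatF H (CC R) f *m weight_cochar X.
Proof.
have hY i : weight_cochar Y *m (hpq Hd Y i.1 i.2 *m bmatF H (CC R) f) =
    bmatF H (CC R) f *m (t ^ (i.1 + i.2) *: hpq Hd X i.1 i.2).
  by rewrite mulmxA weight_cochar_hpq -scalemxAl hpq_nat scalemxAr.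
rewrite -[bmatF _ _ _ in LHS]mulmx1 -(hpq_supp_sum X) !mulmx_sumr.
by apply: eq_bigr => i _; rewrite -hY hpq_nat.
Qed.

(** Hodge types add under tensor product, so the two sides agree on each product of Hodge
    components, and these products sum to the identity. *)
Lemma weight_cochar_tens X Y :
  weight_cochar (tens X Y) *m bmuF H (CC R) X Y =
  bmuF H (CC R) X Y *m (weight_cochar X *t weight_cochar Y).
Proof.
pose h Z (i : int * int) := hpq Hd Z i.1 i.2.
have hh i j : weight_cochar (tens X Y) *m (bmuF H (CC R) X Y *m (h X i *t h Y j)) =
    bmuF H (CC R) X Y *m
      ((t ^ (i.1 + i.2) *: h X i) *t (t ^ (j.1 + j.2) *: h Y j)).
  have -> : (t ^ (i.1 + i.2) *: h X i) *t (t ^ (j.1 + j.2) *: h Y j) =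
      t ^ ((i.1 + j.1) + (i.2 + j.2)) *: (h X i *t h Y j).
    apply/matrixP => a b; rewrite !mxE mulrACA -expfzDr //.
    by congr (t ^ _ * _); rewrite addrACA.
  apply: tensmx_ext => u v; rewrite -!scalemxAr -!scalemxAl -!mulmxA.
  rewrite tensmx_mul -[bmuF _ _ _ _ *m _]/(tvec (bmuF H (CC R) X Y) _ _).
  have hK Z (k : int * int) (w : 'cV_(bdim H Z)) :
      hpq Hd Z k.1 k.2 *m (h Z k *m w) = h Z k *m w.
    by rewrite mulmxA hpq_idem.
  rewrite -(hpq_tens (hK X i u) (hK Y j v)) mulmxA.
  by rewrite (weight_cochar_hpq _ (i.1 + j.1, i.2 + j.2)) -scalemxAl.
have tens_sum (Q1 : int * int -> 'M[CC R]_(bdim H X))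
    (Q2 : int * int -> 'M[CC R]_(bdim H Y)) r1 r2 :
  (\sum_(i <- r1) Q1 i) *t (\sum_(j <- r2) Q2 j) =
  \sum_(i <- r1) \sum_(j <- r2) (Q1 i *t Q2 j).
  apply/matrixP => a b; rewrite mxE !summxE big_distrl; apply: eq_bigr => i _.
  by rewrite !summxE big_distrr; apply: eq_bigr => j _; rewrite mxE.
rewrite -[LHS]mulmx1 -tensmx1 -(hpq_supp_sum X) -(hpq_supp_sum Y) !tens_sum.
rewrite !mulmx_sumr; apply: eq_bigr => i _; rewrite !mulmx_sumr.
by apply: eq_bigr => j _; rewrite -mulmxA hh.
Qed.

End WeightCocharacter.

Lemma weight_cochar_aut (R : realType) (C : tcat) (H : tfunctor C)
    (Hd : hodge R H) (t : CC R) (P : C -> Prop) : t != 0 ->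
  tensor_aut P (weight_cochar Hd t).
Proof.
move=> t0; split.
- move=> X _.
  suff /mulmx1_unit[] : weight_cochar Hd t X *m weight_cochar Hd t^-1 X = 1%:M.
    by [].
  rewrite [weight_cochar Hd t^-1 X]/weight_cochar mulmx_sumr -(hpq_supp_sum Hd X).
  apply: eq_bigr => i _; rewrite -scalemxAr weight_cochar_hpq scalerA.
  by rewrite -expfzMl mulVf // exp1rz scale1r.
- by move=> X Y f _ _; apply: weight_cochar_nat.
- by move=> X Y _ _; apply: weight_cochar_tens.
- by rewrite (weight_cochar_eq t (hpq_one Hd)) addr0 expr0z.
Qed.

(** * Galois elements as tensor automorphisms *)

Lemma rmorphism_eq (A B : nzRingType) (f g : {rmorphism A -> B}) : f =1 g -> f = g.
Proof.
case: f g => [f [[f1] [f2]]] [g [[g1] [g2]]] /= fg.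
have {}fg : f = g by apply/funext.
by subst g; rewrite (Prop_irrelevance f1 g1) (Prop_irrelevance f2 g2).
Qed.

(** Multiplicativity of a representation is stated for the record [gal_comp s t], so inverses are
    needed as an equality of records, proof fields included. *)
Lemma absGal_eq (K : fieldExtType rat) (iota : {rmorphism K -> algC})
  (s t : absGal iota) : (s : algC -> algC) =1 t -> s = t.
Proof.
case: s t => [s sP] [t tP] /= /rmorphism_eq st; subst t.
by rewrite (Prop_irrelevance sP tP).
Qed.

(** An element of [absGal] is only a ring endomorphism; it is invertible because every endomorphism
    of [algC] is an automorphism. *)
Lemma gal_inv_exists (K : fieldExtType rat) (iota : {rmorphism K -> algC})
  (s : absGal iota) : exists t, gal_comp s t = Defs.gal_id iota.
Proof.
have [t tE] : exists t : {rmorphism algC -> algC}, cancel t s.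
  exists (algC_invaut s); exact: algC_invautK.
have tP (x : K) : t (iota x) = iota x.
  by apply: (fmorph_inj s); rewrite tE gal_fix.
by exists (AbsGal tP); apply: absGal_eq => z /=; rewrite tE.
Qed.

Lemma galois_aut (R : realType) (K : fieldExtType rat)
    (iota : {rmorphism K -> algC})
    (Ql : forall l : nat, prime l -> padicField R l) (C : tcat)
    (H : tfunctor C) (E : etale iota Ql H) (l : nat) (pl : prime l)
    (s : absGal iota) (P : C -> Prop) :
  tensor_aut P (fun X => et E pl X s).
Proof.
split.
- move=> X _; have [t st] := gal_inv_exists s.
  have [r1 rM _] := et_rep E pl X.
  by have /mulmx1_unit[] : et E pl X s *m et E pl X t = 1%:M by rewrite -rM st r1.
- by move=> X Y f _ _; apply: et_nat.
- by move=> X Y _ _; apply: et_tens.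
- exact: et_one.
Qed.

Lemma generated_tone (C : tcat) (N : C) : generated N tone.
Proof. by move=> P [] . Qed.

Lemma generated_tens (C : tcat) (N X Y : C) :
  generated N X -> generated N Y -> generated N (tens X Y).
Proof.
by move=> GX GY P Pc PN; apply: (tcl_tens Pc); [apply: GX|apply: GY].
Qed.

Lemma section_monic (D : lincat) (U V : D) (a : mor U V) (b : mor V U) :
  b \oc a = idm U -> Defs.monic a.
Proof.
move=> ba W g ag; rewrite -[g]comp1m -ba -Defs.compA ag.
(* Linearity at zero makes [b \oc 0] equal to its own double, hence zero. *)
have := comp_linr 1 b (0 : mor W V) 0; rewrite !scale1r addr0.
by move/eqP; rewrite -subr_eq0 opprD addNKr oppr_eq0 => /eqP.
Qed.

Lemma generated_summand (C : tcat) (N X Y : C) : direct_sum N X Y ->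
  generated N X /\ generated N Y.
Proof.
move=> [i [j [p [q [pi qj _ _ _]]]]]; split=> P Pc PN.
  exact: (tcl_sub Pc (section_monic pi) PN).
exact: (tcl_sub Pc (section_monic qj) PN).
Qed.

(** * Normalised Frobenius elements in the group of M + T *)

Section MotivicGroups.
Variables (R : realType) (K : fieldExtType rat) (iota : {rmorphism K -> algC}).
Variable jC : {rmorphism algC -> CC R}.
Variable Ql : forall l : nat, prime l -> padicField R l.
Variables (Mo : motives iota jC Ql) (M MT : Mo).
Hypothesis MT_sum : direct_sum MT M (tate Mo).
Local Notation C := (CC R).
Local Notation dM := (bdim (betti Mo) M).
Local Notation dT := (bdim (betti Mo) (tate Mo)).

Definition tembed (a : 'M[C]_dM) : 'M[C]_(dM + dT) := block_mx a 0 0 1%:M.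

Lemma tembedM a b : tembed (a *m b) = tembed a *m tembed b.
Proof. by rewrite /tembed block_diag_mul mulmx1. Qed.

Lemma tAST_tembed a : tAST M MT a -> a = tembed (ulsubmx a).
Proof.
move=> [[g [_ ->]]]; rewrite /diag_block block_mxKdr => g1.
by rewrite /tembed block_mxKul g1.
Qed.

Lemma projV_tembed (A : set 'M[C]_(dM + dT)) a :
  A `<=` tAST M MT -> projV A a <-> A (tembed a).
Proof.
move=> AS; split=> [[b Ab <-]|Aa]; first by rewrite -(tAST_tembed (AS _ Ab)).
by exists (tembed a) => //; rewrite /tembed block_mxKul.
Qed.

Lemma tASTP a : tAST M MT (tembed a) <->
  exists g, [/\ tensor_aut (H := betti Mo) (F := C) (generated MT) g, g M = a &
               g (tate Mo) = 1%:M].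
Proof.
split=> [[[g [gP gE]] _]|[g [gP <- g1]]].
  by exists g; move: gE => /eq_block_mx[-> _ _ ->].
by split; [exists g; split=> //; rewrite /diag_block g1|rewrite block_mxKdr].
Qed.

Lemma tAST_subgroup : is_subgroup (tAST M MT).
Proof.
have [GM GT] := generated_summand MT_sum.
have GN := @generated_tens Mo MT; have G1 := @generated_tone Mo MT.
have unitA a : tAST M MT (tembed a) -> a \in unitmx.
  by move=> /tASTP[g [[gu _ _ _] <- _]]; apply: gu.
have tV a : a \in unitmx -> tembed a *m tembed (invmx a) = 1%:M.
  by move=> au; rewrite -tembedM mulmxV // /tembed block_diag1.
split.
- move=> a /[dup] /tAST_tembed -> /unitA au.
  by have /mulmx1_unit[] := tV _ au.
- rewrite -block_diag1; apply/tASTP; exists (fun X => 1%:M); split=> //; split=> //.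
  + by move=> *; rewrite unitmx1.
  + by move=> *; rewrite mul1mx mulmx1.
  + by move=> *; rewrite tensmx1 mul1mx mulmx1.
- move=> a b /[dup] /tAST_tembed -> /tASTP[g [gP gM gT]].
  move=> /[dup] /tAST_tembed -> /tASTP[h [hP hM hT]].
  rewrite -tembedM; apply/tASTP; exists (fun X => g X *m h X).
  by split; [apply: tensor_autM|rewrite gM hM|rewrite gT hT mulmx1].
- move=> a /[dup] /tAST_tembed -> /[dup] /unitA au /tASTP[g [gP gM gT]].
  rewrite (invmx_uniq (tV _ au)); apply/tASTP; exists (fun X => invmx (g X)).
  by split; [apply: tensor_autV|rewrite gM|rewrite gT invmx1].
Qed.

Lemma frobenius_projV (n : int) (l : nat) (pl : prime l)
    (e : {rmorphism Ql pl -> C}) (v : set K) (sigma : absGal iota)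
    (s : 'M[C]_dM) :
  weight_proj (mhodge Mo) M n = 1%:M -> (0 < residue_card iota v)%N ->
  et (metale Mo) pl (tate Mo) sigma = ((residue_card iota v)%:R)%:M ->
  semisimple_part (qhalf R iota n v *: map_mx e (et (metale Mo) pl M sigma)) s ->
  tAST M MT (tembed s).
Proof.
move=> Mn q0 Tsigma As; pose q : C := (residue_card iota v)%:R.
pose t : C := ofreal (Num.sqrt (residue_card iota v)%:R).
have t2 : t ^+ 2 = q.
  rewrite /t /ofreal -rmorphXn /= sqr_sqrtr ?ler0n // rmorph_nat; reflexivity.
have qn0 : q != 0 by rewrite pnatr_eq0 -lt0n.
have t0 : t != 0 by apply: contra_neq qn0 => t0; rewrite -t2 t0 expr0n.
have [GM GT] := generated_summand MT_sum.
pose g X : 'M[C]_(bdim (betti Mo) X) :=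
  weight_cochar (mhodge Mo) t X *m map_mx e (et (metale Mo) pl X sigma).
have gP : tensor_aut (generated MT) g.
  by apply: tensor_autM; [apply: weight_cochar_aut|apply/tensor_aut_map/galois_aut].
(* Membership in the motivic group needs a witness on every object, so semisimple parts are chosen
   everywhere; uniqueness then identifies those at [M] and at [tate Mo]. *)
pose ss X := projT1 (cid (semisimple_part_exists (g X))).
have ssP X : semisimple_part (g X) (ss X) by rewrite /ss; case: cid.
apply/tASTP; exists ss; split.
- apply: tensor_aut_semisimple gP _ => //; first exact: generated_tone.
  exact: generated_tens.
- apply: semisimple_part_unique (ssP M) _.
  by rewrite /g (weight_cochar_pure t Mn) mul_scalar_mx.
- apply: semisimple_part_unique (ssP _) _.
  rewrite /g (weight_cochar_eq t (tate_hodge Mo)) Tsigma map_scalar_mx rmorph_nat.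
  rewrite mul_scalar_mx scale_scalar_mx -/q -t2.
  have -> : t ^ (-1 + -1) * t ^+ 2 = 1.
    by rewrite -[t ^+ 2]/(t ^ 2%:Z) -expfzDr.
  exact: semisimple_part_scalar.
Qed.
End MotivicGroups.
(** * Primes of number fields *)

Record subring_set (A : comNzRingType) (O : set A) : Prop := SubringSet {
  subring_set1 : O 1;
  subring_setB : forall x y, O x -> O y -> O (x - y);
  subring_setM : forall x y, O x -> O y -> O (x * y) }.

Section PrimeIdeals.
Variables (A : comNzRingType) (O : set A) (hO : subring_set O).

Lemma subring_set0 : O 0.
Proof. by rewrite -(subrr 1); apply: (subring_setB hO); apply: (subring_set1 hO). Qed.

Lemma subring_setN x : O x -> O (- x).
Proof. by move=> Ox; rewrite -sub0r; apply: (subring_setB hO) => //; apply: subring_set0. Qed.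

Lemma subring_setD x y : O x -> O y -> O (x + y).
Proof. by move=> Ox Oy; rewrite -[y]opprK; apply: (subring_setB hO) => //; apply: subring_setN. Qed.

Lemma subring_setX x k : O x -> O (x ^+ k).
Proof.
by move=> Ox; elim: k => [|k IH]; [apply: (subring_set1 hO)|rewrite exprS; apply: (subring_setM hO)].
Qed.

Lemma subring_set_nat k : O k%:R.
Proof.
by elim: k => [|k IH]; [exact: subring_set0|rewrite -natr1; apply: subring_setD => //; apply: (subring_set1 hO)].
Qed.

Lemma subring_set_int k : O k%:~R.
Proof. by case: k => k; [exact: subring_set_nat|rewrite NegzE rmorphN; apply: subring_setN; exact: subring_set_nat]. Qed.

Lemma exists_prime_ideal (p : A) : O p -> ~ (exists2 y, O y & 1 = p * y) ->
  exists2 P, prime_ideal O P & P p.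
Proof.
move=> Op pnu.
(* The last condition means 1 \notin I + pO. The set I may be empty, since
   Zorn_bigcup considers the empty chain. *)
pose T (I : set A) := [/\ I `<=` O, forall x y, I x -> I y -> I (x + y),
  forall a x, O a -> I x -> I (a * x) &
  ~ exists x y, [/\ I x, O y & 1 = x + p * y]].
have [|I [[IO ID IM I1] Imax]] := @Zorn_bigcup A T.
  move=> F FT Ftot; split.
  - by move=> x [X FX Xx]; case: (FT _ FX) => + _ _ _; apply.
  - move=> x y [X FX Xx] [Y FY Yy]; case: (Ftot _ _ FX FY) => XY.
      by exists Y => //; case: (FT _ FY) => _ + _ _; apply=> //; apply: XY.
    by exists X => //; case: (FT _ FX) => _ + _ _; apply=> //; apply: XY.
  - move=> a x Oa [X FX Xx]; exists X => //.
    by case: (FT _ FX) => _ _ + _; apply.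
  - move=> [x [y [[X FX Xx] Oy E]]].
    by case: (FT _ FX) => _ _ _; apply; exists x, y.
have I0 : I 0.
  have [[x Ix]|In] := pselect (exists x, I x).
    by rewrite -(mul0r x); apply: IM => //; exact: subring_set0.
  (* An empty [I] would lie properly inside the zero ideal, which satisfies [T] because [p] is not a
     unit. *)
  exfalso; apply: (Imax [set 0]).
    split=> [x Ix|/(_ 0 erefl) I0]; last by apply: In; exists 0.
    by exfalso; apply: In; exists x.
  split=> [x ->|x y -> ->|a x _ ->|[x [y [-> Oy]]]].
  - exact: subring_set0.
  - by rewrite addr0.
  - by rewrite mulr0.
  - by rewrite add0r => E; apply: pnu; exists y.
(* By maximality, the ideal generated by [I] and [z] must violate the last condition of [T]. *)
have Iext z : O z -> ~ I z -> exists b a y, [/\ I b, O a, O y & 1 = b + z * a + p * y].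
  move=> Oz Iz; apply: contrapT => nE.
  apply: (Imax [set x | exists b a, [/\ I b, O a & x = b + z * a]]).
    split=> [x Ix|sub].
      by exists x, 0; rewrite mulr0 addr0; split=> //; exact: subring_set0.
    apply: Iz; apply: sub; exists 0, 1; rewrite mulr1 add0r; split=> //.
    exact: (subring_set1 hO).
  split=> [x [b [a [Ib Oa ->]]]|x y [b [a [Ib Oa ->]]] [b' [a' [Ib' Oa' ->]]]|
           c x Oc [b [a [Ib Oa ->]]]|[x [y [[b [a [Ib Oa ->]]] Oy E]]]].
  - by apply: subring_setD; [exact: IO|exact: (subring_setM hO)].
  - by exists (b + b'), (a + a'); split; [exact: ID|exact: subring_setD|ring].
  - by exists (c * b), (c * a); split; [exact: IM|exact: (subring_setM hO)|ring].
  - by apply: nE; exists b, a, y.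
have Ip : I p.
  apply: contrapT => nIp; have [b [a [y [Ib Oa Oy E]]]] := Iext p Op nIp.
  apply: I1; exists b, (a + y); split=> //; first exact: subring_setD.
  by rewrite E; ring.
exists I => //; split=> //.
- move=> H1; apply: I1; exists 1, 0; rewrite mulr0 addr0; split=> //; exact: subring_set0.
- move=> x y Ox Oy Ixy; have [|nIx] := pselect (I x); [by left|right].
  have [b [a [c [Ib Oa Oc E]]]] := Iext x Ox nIx.
  rewrite -[y]mul1r E.
  have -> : (b + x * a + p * c) * y = y * b + a * (x * y) + (c * y) * p by ring.
  by apply: (ID); [apply: (ID); apply: (IM)|apply: IM => //; apply: (subring_setM hO)].
Qed.

Variables (P : set A) (hP : prime_ideal O P).

Lemma pi_N x : P x -> P (- x).
Proof.
by move=> Px; rewrite -mulN1r; apply: (pi_M hP) => //; apply/subring_setN/(subring_set1 hO).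
Qed.

Lemma pi_B x y : P x -> P y -> P (x - y).
Proof. by move=> Px Py; apply: (pi_D hP) => //; apply: pi_N. Qed.

Lemma pi_addl x y : P x -> P (x + y) -> P y.
Proof. by move=> Px /pi_B/(_ Px); rewrite addrAC subrr add0r. Qed.

Lemma pi_mulX x y k : O x -> O y -> P (x ^+ k * y) -> P x \/ P y.
Proof.
move=> Ox Oy; elim: k => [|k IH]; first by rewrite expr0 mul1r; right.
have Oxk : O (x ^+ k * y) by apply: (subring_setM hO) => //; apply: subring_setX.
by rewrite exprS -mulrA => /(pi_prime hP Ox Oxk)[|/IH //]; left.
Qed.

Lemma pi_X x k : O x -> P (x ^+ k) -> P x.
Proof.
move=> Ox; rewrite -[_ ^+ _]mulr1 => /pi_mulX; case=> //.
  exact: (subring_set1 hO).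
by move=> /(pi_1 hP).
Qed.

(** Otherwise a Bezout relation between [p] and [k] would put 1 into [P]. *)
Lemma pi_natr_dvd p k : prime p -> P p%:R -> P k%:R -> (p %| k)%N.
Proof.
move=> pp Pp Pk; apply: contrapT => /negP pk.
have /eqP cpk : coprime p k by rewrite prime_coprime.
have [a b E _] := egcdnP k (prime_gt0 pp); rewrite cpk in E.
apply: (pi_1 hP); apply: (@pi_addl (b%:R * k%:R)).
  by apply: (pi_M hP) => //; exact: subring_set_nat.
rewrite -natrM natr1 -addn1 -E natrM; apply: (pi_M hP) => //; exact: subring_set_nat.
Qed.

Lemma pi_intr_dvd p (k : int) : prime p -> P p%:R -> P k%:~R -> (p %| `|k|)%N.
Proof.
move=> pp Pp; case: k => k; first exact: pi_natr_dvd.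
rewrite NegzE rmorphN => /pi_N; rewrite opprK abszN.
exact: pi_natr_dvd.
Qed.

Lemma pi_natr_prime k : (0 < k)%N -> P k%:R ->
  exists2 p, prime p & (p <= k)%N /\ P p%:R.
Proof.
elim/ltn_ind: k => k IH k0 Pk.
have k1 : (1 < k)%N.
  by rewrite ltn_neqAle k0 andbT; apply/eqP => k1; apply: (pi_1 hP); move: Pk; rewrite -k1.
move: Pk; rewrite -(divnK (pdiv_dvd k)) natrM => /(pi_prime hP (subring_set_nat _) (subring_set_nat _))[].
  have lt : (k %/ pdiv k < k)%N by rewrite ltn_Pdiv // prime_gt1 // pdiv_prime.
  move=> /(IH _ lt); case.
    by rewrite divn_gt0 ?pdiv_gt0 // dvdn_leq // pdiv_dvd.
  move=> p pp [pk Pp]; exists p => //; split=> //.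
  by rewrite (divnK (pdiv_dvd k)) (leq_trans pk) // ltnW.
move=> Pp; exists (pdiv k); first exact: pdiv_prime.
by split=> //; rewrite (divnK (pdiv_dvd k)) dvdn_leq // pdiv_dvd.
Qed.

End PrimeIdeals.
Section NumberFieldPrimes.
Variables (K : fieldExtType rat) (iota : {rmorphism K -> algC}).

Lemma algints_subring : subring_set algints.
Proof.
split=> [|x y|x y]; rewrite /algints /=.
- exact: rpred1.
- exact: rpredB.
- exact: rpredM.
Qed.

Lemma intK_subring : subring_set (intK iota).
Proof.
split=> [|x y|x y]; rewrite /intK /preimage /=.
- by rewrite rmorph1; apply: (subring_set1 algints_subring).
- by rewrite rmorphB; apply: (subring_setB algints_subring).
- by rewrite rmorphM; apply: (subring_setM algints_subring).
Qed.

Lemma primeK_over (p : nat) : prime p -> exists2 v, primeK iota v & v p%:R.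
Proof.
move=> pp; have p0 : (p%:R : algC) != 0 by rewrite pnatr_eq0 -lt0n prime_gt0.
have [||v vP vp] := exists_prime_ideal intK_subring (p := p%:R).
- exact: (subring_set_nat intK_subring).
(* An inverse of [p] would be a rational algebraic integer, hence an integer. *)
- move=> [y Oy /(congr1 iota)]; rewrite rmorph1 rmorphM rmorph_nat => E.
  have yE : iota y = p%:R^-1 by apply: (mulfI p0); rewrite -E divff.
  have /intrP[k kE] : iota y \is a Num.int.
    apply: Cint_rat_Aint; last exact: Oy.
    by rewrite yE rpredV rpred_nat.
  move: E; rewrite kE -[p%:R]/(p%:~R) -intrM -[1]/(1%:~R) => /intr_inj /esym.
  move/(congr1 absz); rewrite abszM /= => /eqP; rewrite muln_eq1.
  by move=> /andP[/eqP p1 _]; rewrite p1 in pp.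
exists v => //; split=> //; exists p%:R => //.
by apply: contra_neq p0 => p0; rewrite -(rmorph_nat iota) p0 rmorph0.
Qed.

Lemma residue_pigeonhole (v : set K) (u : nat -> K) :
  residue_card iota v != 0%N -> v 0 -> (forall i, intK iota (u i)) ->
  exists i j, [/\ (i < j)%N, (j <= residue_card iota v)%N & v (u j - u i)].
Proof.
rewrite /residue_card; set Q := [set _ | _ in _].
(* For infinitely many classes [fset_set] is empty and [residue_card] is 0, which is excluded. *)
have [Qf|Qf] := pselect (finite_set Q); last first.
  rewrite (_ : fset_set Q = fset0) ?cardfs0 // /fset_set.
  by case: pselect.
move=> _ v0 uO.
pose cl i : set K := [set y | intK iota y /\ v (y - u i)].
have clQ i : cl i \in fset_set Q.
  by rewrite in_fset_set //; apply/mem_set; exists (u i).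
pose f (i : 'I_(#|` fset_set Q|.+1)) := FSetSub (clQ i).
have : ~ injective f.
  by move=> /leq_card; rewrite card_ord -cardfE ltnn.
move=> /injectiveP/injectivePn[i [j ij fij]].
have clij : cl i = cl j by move: fij => [].
have vji : v (u i - u j).
  have : cl i (u i) by rewrite /cl /= subrr.
  by rewrite clij => -[].
have vij : v (u j - u i).
  have : cl j (u j) by rewrite /cl /= subrr.
  by rewrite -clij => -[].
have [lt|lt|eq] := ltngtP i j.
- by exists i, j; split=> //; rewrite -ltnS ltn_ord.
- by exists j, i; split=> //; rewrite -ltnS ltn_ord.
- by move/eqP: ij; case; apply: val_inj.
Qed.

(** Finiteness of the residue ring makes two powers of [x] congruent modulo [v], so x^i (x^(j-i) -
    1) lies in [v]. If [x] is not in [v], then x^(j-i) - 1 is in [v], hence in [w], and [x] in [w]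
    would force 1 into [w]. *)
Lemma residue_card_incomparable (v w : set K) :
  primeK iota v -> primeK iota w -> residue_card iota v != 0%N ->
  v `<=` w -> w `<=` v.
Proof.
move=> [vP _] [wP _] v0 vw x wx; apply: contrapT => vx.
have Ox : intK iota x by apply: (pi_sub wP).
have [i [j [ij _ vij]]] :=
  residue_pigeonhole v0 (pi_0 vP) (fun i => subring_setX intK_subring i Ox).
have Oji : intK iota (x ^+ (j - i) - 1).
  by apply: (subring_setB intK_subring); [apply: (subring_setX intK_subring)|apply: (subring_set1 intK_subring)].
have : v (x ^+ i * (x ^+ (j - i) - 1)).
  by rewrite mulrBr mulr1 -exprD subnKC // ltnW.
case/(pi_mulX intK_subring vP Ox Oji) => // /vw w1.
apply: (pi_1 wP); apply: (pi_addl (x := - x ^+ (j - i)) intK_subring wP).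
  apply: (pi_N intK_subring wP); case: (j - i)%N (subn_gt0 i j) => [|k _]; first by rewrite ij.
  by rewrite exprSr; apply: (pi_M wP) => //; apply: (subring_setX intK_subring).
by rewrite -[X in w (_ + X)]opprK -opprD; apply: (pi_N intK_subring wP).
Qed.

Lemma common_denominator n (k : 'I_n -> rat) :
  exists D : int, D != 0 /\ exists c : 'I_n -> int, forall i, (c i)%:~R = D%:~R * k i.
Proof.
exists (\prod_i denq (k i)); split; first by apply/prodf_neq0 => i _; exact: denq_neq0.
exists (fun i => numq (k i) * \prod_(j | j != i) denq (k j)) => i.
by rewrite [in RHS](bigD1 i) //= !intrM numqE [RHS]mulrC mulrA.
Qed.

(** A descent: modulo the j-th prime only the j-th term survives, so [p] divides every coefficient.
    Dividing the relation by [p] and repeating shows that all powers of [p] divide them. *)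
Lemma separated_by_primes_independent (N p : nat) (v : 'I_N -> set K) (x : 'I_N -> K) :
  prime p -> (forall i, prime_ideal (intK iota) (v i)) -> (forall i, v i p%:R) ->
  (forall i, intK iota (x i)) -> (forall i, ~ v i (x i)) ->
  (forall i j, i != j -> v i (x j)) ->
  forall c : 'I_N -> int, \sum_i (c i)%:~R * x i = 0 -> forall i, c i = 0.
Proof.
move=> pp vP vp xO vx vxj c c0 i.
have divp (b : 'I_N -> int) : \sum_i (b i)%:~R * x i = 0 -> forall i, (p %| `|b i|)%N.
  move=> b0 j; apply: (pi_intr_dvd intK_subring (vP j) pp (vp j)).
  have : v j ((b j)%:~R * x j).
    move: b0; rewrite (bigD1 j) //= => /eqP; rewrite addr_eq0 => /eqP ->.
    apply: (pi_N intK_subring (vP j)).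
    elim/big_ind: _ => [|y z|k kj]; [exact: (pi_0 (vP j))|exact: (pi_D (vP j))|].
    by apply: (pi_M (vP j)); [exact: subring_set_int intK_subring _|apply: vxj; rewrite eq_sym].
  by case/(pi_prime (vP j) (subring_set_int intK_subring _) (xO j)) => // /vx.
have divpm m : forall b : 'I_N -> int, \sum_i (b i)%:~R * x i = 0 ->
    forall i, (p ^ m %| `|b i|)%N.
  elim: m => [|m IH] b b0 j; first by rewrite expn0 dvd1n.
  have pb := divp _ b0.
  pose b' j := (b j %/ p)%Z.
  have bE k : b k = p%:Z * b' k by rewrite mulrC divzK // unfold_in /= pb.
  rewrite bE abszM expnS dvdn_pmul2l ?prime_gt0 //; apply: IH.
  have p0 : (p%:R : K) != 0.
    by rewrite -(fmorph_eq0 iota) rmorph_nat pnatr_eq0 -lt0n prime_gt0.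
  apply: (mulfI p0); rewrite mulr0 -[RHS]b0 mulr_sumr; apply: eq_bigr => k _.
  by rewrite [in RHS]bE intrM mulrA.
apply/eqP; rewrite -absz_eq0; apply: contraT => ci0.
(* The exponent |c_i| suffices, since p^|c_i| exceeds |c_i|. *)
have := dvdn_leq _ (divpm `|c i|%N c c0 i); rewrite lt0n => /(_ ci0).
by rewrite leqNgt ltn_expl // prime_gt1.
Qed.

(* With x_i in all of the primes except the i-th one, reducing a primitive
   integral relation modulo each of them shows that the x_i are independent over Q,
   so that there are at most [K : Q] primes. *)
Lemma finite_primes_over (p : nat) : prime p ->
  finite_set [set v | [/\ primeK iota v, residue_card iota v != 0%N & v p%:R]].
Proof.
move=> pp; apply: contrapT => /(infinite_set_fset (\dim {:K}).+1)[B Bsub sB].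
have BP v : v \in B -> [/\ primeK iota v, residue_card iota v != 0%N & v p%:R].
  by move=> vB; apply: (Bsub v).
pose n := #|` B|; pose vv (i : 'I_n) : set K := nth set0 B i.
have vB i : vv i \in B by rewrite mem_nth.
have vinj i j : i != j -> vv i != vv j.
  by rewrite /vv nth_uniq // fset_uniq.
(* With [i != j] under the existential, choice gives a total function [y i j]. *)
have sep i j : exists y, i != j -> [/\ intK iota y, vv j y & ~ vv i y].
  have [->|ij] := eqVneq i j; first by exists 0.
  have [wP w0 _] := BP _ (vB j); have [vP _ _] := BP _ (vB i).
  apply: contrapT => nE; move/eqP: (vinj _ _ ij); apply.
  have ji : vv j `<=` vv i.
    move=> y wy; apply: contrapT => vy; apply: nE; exists y => _; split=> //.
    by case: wP => wP _; apply: (pi_sub wP).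
  by apply/seteqP; split=> //; apply: residue_card_incomparable ji.
pose y i j := projT1 (cid (sep i j)).
have yP i j : i != j -> [/\ intK iota (y i j), vv j (y i j) & ~ vv i (y i j)].
  by rewrite /y; case: cid.
pose x i := \prod_(j | j != i) y i j.
have vP i : prime_ideal (intK iota) (vv i) by have [[]] := BP _ (vB i).
have xO i : intK iota (x i).
  rewrite /x; elim/big_ind: _ => [|a b|j ji].
  - exact: (subring_set1 intK_subring).
  - exact: (subring_setM intK_subring).
  - by have [] : [/\ intK iota (y i j), vv j (y i j) & ~ vv i (y i j)]
      by apply: yP; rewrite eq_sym.
have xv i : ~ vv i (x i).
  suff [] : intK iota (x i) /\ ~ vv i (x i) by [].
  rewrite /x; elim/big_ind: _ => [|a b [Oa va] [Ob vb]|j ji].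
  - by split; [exact: (subring_set1 intK_subring)|exact: (pi_1 (vP i))].
  - by split; [exact: (subring_setM intK_subring)|move=> /(pi_prime (vP i) Oa Ob)[]].
  - by have [] : [/\ intK iota (y i j), vv j (y i j) & ~ vv i (y i j)]
      by apply: yP; rewrite eq_sym.
have xvj i j : i != j -> vv i (x j).
  move=> ij; rewrite /x (bigD1 i) //= mulrC; have [_ yi _] := yP j i (ltac:(by rewrite eq_sym)).
  apply: (pi_M (vP i)) => //; elim/big_ind: _ => [|a b|k /andP[kj _]].
  - exact: (subring_set1 intK_subring).
  - exact: (subring_setM intK_subring).
  - by have [] : [/\ intK iota (y j k), vv k (y j k) & ~ vv j (y j k)]
      by apply: yP; rewrite eq_sym.
have : free [tuple x i | i < n].
  apply/freeP => k k0 i.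
  have [D [D0 [c cE]]] := common_denominator k.
  have c0 : \sum_i (c i)%:~R * x i = 0.
    have := congr1 (fun z : K => (D%:~R : rat) *: z) k0.
    rewrite scaler0 scaler_sumr; apply: etrans; apply: eq_bigr => j _.
    rewrite -tnth_nth tnth_mktuple scalerA -cE.
    by rewrite scaler_int mulrzl.
  have vp j : vv j p%:R by have [] := BP _ (vB j).
  have ci0 := separated_by_primes_independent pp vP vp xO xv xvj c0 i.
  have := cE i; rewrite ci0 => /esym/eqP; rewrite mulf_eq0 intr_eq0 (negPf D0) /=.
  by move/eqP.
rewrite /free size_tuple => /eqP nE.
have := dimvS (subvf <<[tuple x i | i < n]>>%VS).
by rewrite nE leqNgt sB.
Qed.
End NumberFieldPrimes.

(** * Primes of bounded norm, Frobenius elements and roots of unity *)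

Section Frobenius.
Variables (K : fieldExtType rat) (iota : {rmorphism K -> algC}).

(** By pigeonhole two of the integers 0, ..., m agree modulo [v], so [v] contains a positive integer
    at most [m] and then a rational prime at most [m]; finitely many [v] lie over each of these. *)
Lemma finite_residue_card_le (m : nat) :
  finite_set [set v | [/\ primeK iota v, residue_card iota v != 0%N &
                          (residue_card iota v <= m)%N]].
Proof.
pose F p := [set v | [/\ primeK iota v, residue_card iota v != 0%N & v p%:R]].
apply: (@sub_finite_set _ _ (\bigcup_(p in [set p | prime p /\ (p <= m)%N]) F p)).
  move=> v [vP v0 vm]; have [vI _] := vP.
  have [i [j [ij jv vij]]] :=
    residue_pigeonhole v0 (pi_0 vI) (subring_set_nat (intK_subring iota)).
  have [||p pp [pj vp]] := @pi_natr_prime _ _ (intK_subring iota) _ vI (j - i).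
  - by rewrite subn_gt0.
  - by rewrite natrB // ltnW.
  exists p => //; split=> //.
  by rewrite (leq_trans pj) // (leq_trans (leq_subr _ _)) // (leq_trans jv).
apply: bigcup_finite => [|p [pp _]]; last exact: finite_primes_over.
by apply: (sub_finite_set _ (finite_II m.+1)) => p [_ pm]; rewrite /= ltnS.
Qed.

Lemma exists_primeK_notin (S : set (set K)) : finite_set S ->
  exists2 v, primeK iota v & ~ S v.
Proof.
move=> Sf; apply: contrapT => nE.
(* [g v] is the residue characteristic, with default 0. A rational prime beyond all its values on
   [S] has only primes outside [S] above it. *)
pose g (v : set K) : nat := xget 0%N [set p | prime p /\ v p%:R].
have gf := finite_image g Sf.
pose N := \max_(i <- fset_set (g @` S)) i.
have [p Np pp] := prime.prime_above N.
have [v vP vp] := primeK_over iota pp.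
have Sv : S v by apply: contrapT => Sv; apply: nE; exists v.
have gv : g v = p.
  rewrite /g; case: xgetP => [q _ [qp vq]|/(_ p)]; last by case.
  have [vI _] := vP.
  have := pi_natr_dvd (intK_subring iota) vI pp vp vq.
  by rewrite dvdn_prime2 // => /eqP.
have : (p <= N)%N.
  by rewrite /N; apply: leq_bigmax_seq => //; rewrite in_fset_set // -gv; apply/mem_set; exists v.
by rewrite leqNgt Np.
Qed.

(** If u were not 1, its powers u^i for i < l^k would sum to 0. Each of them is 1 modulo [P], so
    l^k, and hence l, would lie in [P]. *)
Lemma unity_root_congr_1 (P : set algC) (l k : nat) (u : algC) :
  prime_ideal algints P -> prime l -> ~ P l%:R ->
  u ^+ (l ^ k) = 1 -> P (u - 1) -> u = 1.
Proof.
move=> hP pl Pl uN Pu; apply/eqP; apply: contra_notT Pl => u1.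
have N0 : (0 < l ^ k)%N by rewrite expn_gt0 prime_gt0.
have Ou : algints u by apply: (Aint_unity_root N0); apply/unity_rootP.
have hO := algints_subring.
apply: (pi_X hO hP (k := k)); first exact: (subring_set_nat hO).
rewrite -natrX.
have sum0 : \sum_(i < l ^ k) u ^+ i = 0.
  apply/eqP; have := subrX1 u (l ^ k); rewrite uN subrr => /esym/eqP.
  by rewrite mulf_eq0 subr_eq0 (negPf u1).
have -> : (l ^ k)%:R = - \sum_(i < l ^ k) (u ^+ i - 1).
  by rewrite sumrB sum0 sub0r opprK sumr_const card_ord.
apply: (pi_N hO hP); elim/big_ind: _ => [|x y|i _].
- exact: (pi_0 hP).
- exact: (pi_D hP).
rewrite subrX1 mulrC; apply: (pi_M hP) => //.
elim/big_ind: _ => [|x y|j _]; [exact: (subring_set0 hO)|exact: (subring_setD hO)|exact: (subring_setX hO)].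
Qed.

(** Away from [l], roots of unity of [l]-power order stay distinct modulo [P]. This turns the
    Frobenius congruence into an equality, through the root of unity s(z) / z^q. *)
Lemma frobenius_unity_root (v : set K) (s : absGal iota) (l k : nat) (z : algC) :
  frobenius v s -> prime l -> ~ v l%:R -> z ^+ (l ^ k) = 1 ->
  s z = z ^+ residue_card iota v.
Proof.
move=> [P [hP Pv] sP] pl vl zN.
have N0 : (0 < l ^ k)%N by rewrite expn_gt0 prime_gt0.
have hO := algints_subring.
have Pl : ~ P l%:R.
  by move=> Pl; apply: vl; apply/Pv; [exact: (subring_set_nat (intK_subring iota))|rewrite rmorph_nat].
set q := residue_card iota v.
have z0 : z != 0.
  by apply/eqP => z0; move/eqP: zN; rewrite z0 expr0n eqn0Ngt N0 eq_sym oner_eq0.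
have zq0 : z ^+ q != 0 by rewrite expf_neq0.
have Oz : algints z by apply: (Aint_unity_root N0); apply/unity_rootP.
have OzV : algints (z ^- q).
  apply: (Aint_unity_root N0); apply/unity_rootP.
  by rewrite exprVn -exprM mulnC exprM zN expr1n invr1.
apply: (mulIf (invr_neq0 zq0)); rewrite divff //.
apply: (unity_root_congr_1 hP pl Pl (k := k)).
  by rewrite exprMn exprVn -exprM mulnC exprM zN expr1n invr1 mulr1 -rmorphXn zN rmorph1.
have -> : s z / z ^+ q - 1 = z ^- q * (s z - z ^+ q).
  by rewrite mulrBr mulVf // mulrC.
exact: (pi_M hP OzV (sP _ Oz)).
Qed.

(* residue_card takes the junk value 0 on infinite residue fields; then Frobenius
   would send an l-th root of unity z != 1 to z ^+ 0 = 1. *)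
Lemma frobenius_residue_card (v : set K) (s : absGal iota) (l : nat) :
  frobenius v s -> prime l -> ~ v l%:R -> residue_card iota v != 0%N.
Proof.
move=> sF pl vl; apply/eqP => q0.
have [z zP] := C_prim_root_exists (prime_gt0 pl).
have := frobenius_unity_root (k := 1) sF pl vl; rewrite expn1 => /(_ z (prim_expr_order zP)).
rewrite q0 expr0 -(rmorph1 s) => /fmorph_inj z1.
by have := eq_prim_root_expr zP 1 0; rewrite z1 expr1n expr0 eqxx mod0n modn_small ?prime_gt1.
Qed.

(** * The l-adic absolute value and the cyclotomic character at Frobenius *)

Section PadicAbs.
Variables (R : realType) (l : nat) (pl : prime l) (F : padicField R l).

Lemma pabs0 : pabs (0 : F) = 0.
Proof. exact/pabs_eq0. Qed.

Lemma pabs1 : pabs (1 : F) = 1.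
Proof.
have n0 : pabs (1 : F) != 0 by apply/eqP => /pabs_eq0/eqP; rewrite oner_eq0.
by apply: (mulfI n0); rewrite -pabsM !mulr1.
Qed.

(* Nonnegativity of pabs is not part of padicField. If pabs (-1) were -1, then
   pabs (- k) <= -1 for all k > 0, which contradicts pabs l < 1 = pabs 1. *)
Lemma pabsN1 : pabs (-1 : F) = 1.
Proof.
have : pabs (-1 : F) ^+ 2 == 1 by rewrite expr2 -pabsM mulrNN mulr1 pabs1.
rewrite sqrf_eq1 => /orP[/eqP//|/eqP N1].
have neg k : pabs (- k.+1%:R : F) <= -1.
  elim: k => [|k IH]; first by rewrite N1.
  rewrite -natr1 opprD (le_trans (pabsD _ _)) // ge_max IH /= N1 //.
have : pabs (1 : F) <= Num.max (pabs (l%:R : F)) (pabs (- l.-1%:R : F)).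
  apply: le_trans (pabsD _ _).
  have -> : (l%:R : F) = l.-1%:R + 1 by rewrite natr1 prednK ?prime_gt0.
  by rewrite addrAC subrr add0r.
rewrite pabs1 pabs_l le_max => /orP[|].
  by rewrite invf_ge1 ?ltr0n ?prime_gt0 // lern1 leqNgt prime_gt1.
have -> : l.-1 = l.-2.+1 by rewrite prednK // -subn1 subn_gt0 prime_gt1.
move=> /le_trans/(_ (neg _)); lra.
Qed.

Lemma pabsN (x : F) : pabs (- x) = pabs x.
Proof. by rewrite -mulN1r pabsM pabsN1 mul1r. Qed.

Lemma pabs_ge0 (x : F) : 0 <= pabs x.
Proof. by rewrite -pabs0 -(subrr x) (le_trans (pabsD _ _)) // pabsN maxxx. Qed.

Lemma pabs_nat (k : nat) : pabs (k%:R : F) <= 1.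
Proof.
elim: k => [|k IH]; first by rewrite pabs0 ler01.
by rewrite -natr1 (le_trans (pabsD _ _)) // ge_max IH pabs1 /=.
Qed.

Lemma pabs_natB (a b k : nat) : (a = b %[mod l ^ k])%N ->
  pabs (a%:R - b%:R : F) <= (l%:R ^+ k)^-1.
Proof.
wlog ba : a b / (b <= a)%N.
  move=> W ab; have [/W|/ltnW/W] := leqP b a; first exact.
  by rewrite -pabsN opprB; apply.
move/eqP; rewrite eqn_mod_dvd // -natrB // => /dvdnP[c ->].
rewrite natrM natrX pabsM.
have -> : pabs ((l%:R : F) ^+ k) = (l%:R ^+ k)^-1.
  elim: k => [|k IH]; first by rewrite !expr0 pabs1 invr1.
  by rewrite !exprS pabsM IH pabs_l invfM.
by rewrite ler_piMl ?pabs_nat // invr_ge0 exprn_ge0.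
Qed.

(** A primitive root of unity of order l^k is raised to a power [a] approximating [chi s], and also
    to the power q. So [chi s] and q agree modulo every power of l. *)
Lemma cyclotomic_frobenius (chi : absGal iota -> F) (v : set K) (s : absGal iota) :
  cyclotomic_char chi -> frobenius v s -> ~ v l%:R ->
  chi s = (residue_card iota v)%:R.
Proof.
move=> chiP sF vl; set q := residue_card iota v.
have le k : pabs (chi s - q%:R) <= (l%:R ^+ k)^-1.
  have [a [chia za]] := chiP s k.
  have N0 : (0 < l ^ k)%N by rewrite expn_gt0 prime_gt0.
  have [z zP] := C_prim_root_exists N0.
  have zN := prim_expr_order zP.
  have /eqP aq : z ^+ a == z ^+ q.
    by rewrite -za // (frobenius_unity_root sF pl vl zN).
  move/eqP: aq; rewrite (eq_prim_root_expr zP) => /eqP/pabs_natB aq.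
  have -> : chi s - q%:R = (chi s - a%:R) + (a%:R - q%:R) by rewrite addrA subrK.
  by rewrite (le_trans (pabsD _ _)) // ge_max chia.
apply/eqP; rewrite -subr_eq0; apply/eqP/pabs_eq0/eqP.
rewrite eq_le pabs_ge0 andbT leNgt; apply/negP => x0.
set x := pabs _ in x0 le.
have [k kx] : exists k, x^-1 < l%:R ^+ k :> R.
  have := archi_boundP (ltW (_ : 0 < x^-1)); rewrite invr_gt0 => /(_ x0) lt.
  exists (Num.bound x^-1); apply: (lt_le_trans lt).
  by rewrite -natrX ler_nat ltnW // ltn_expl // prime_gt1.
have := le k; rewrite leNgt => /negP; apply.
by rewrite -[x]invrK ltf_pV2 // posrE ?invr_gt0 // exprn_gt0 // ltr0n prime_gt0.
Qed.
End PadicAbs.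
End Frobenius.
(** * Topology and measure on matrices *)

Lemma matrix_continuous (K : numFieldType) (T : topologicalType) m n (f : T -> 'M[K]_(m, n)) :
  (forall i j, continuous (fun x => f x i j)) -> continuous f.
Proof.
move=> fc x A [P Pn PA].
have : \forall y \near x, forall i j, P i j (f y i j).
  by apply: filter_forall => i; apply: filter_forall => j; apply: fc; apply: Pn.
by apply: filterS => y Py; apply: PA.
Qed.

Lemma continuous_lincomb (K : numFieldType) (T : topologicalType) (I : Type)
    (r : seq I) (c : I -> K) (f : I -> T -> K) :
  (forall i, continuous (f i)) -> continuous (fun x => \sum_(i <- r) c i * f i x).
Proof.
move=> fc; elim: r => [|i r IH].
  rewrite (_ : (fun x => _) = cst (0 : K)); first exact: cst_continuous.
  by apply/funext => x; rewrite big_nil.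
rewrite (_ : (fun x => _) = (fun x => c i * f i x + \sum_(j <- r) c j * f j x)).
  move=> x; apply: cvgD; last exact: IH.
  by apply: cvgM; [exact: cvg_cst|exact: fc].
by apply/funext => x; rewrite big_cons.
Qed.

Lemma continuous_mulmxl (K : numFieldType) m n (g : 'M[K]_m) :
  continuous (fun a : 'M[K]_(m, n) => g *m a).
Proof.
apply: matrix_continuous => i j.
rewrite (_ : (fun x => _) =
    (fun x : 'M[K]_(m, n) => \sum_(k <- index_enum 'I_m) g i k * x k j)); last first.
  by apply/funext => x; rewrite mxE.
apply: continuous_lincomb => k; exact: coord_continuous.
Qed.

Section MatrixTopology.
Variable R : realType.
Local Notation C := (CC R).

Lemma continuous_ulsubmx m n : continuous (ulsubmx : 'M[C]_(m + n) -> 'M[C]_m).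
Proof.
apply: matrix_continuous => i j.
rewrite (_ : (fun x => _) = (fun x : 'M[C]_(m + n) => x (lshift n i) (lshift n j))).
  exact: coord_continuous.
by apply/funext => x; rewrite !mxE.
Qed.

Lemma continuous_block_diag1 m n :
  continuous (fun a : 'M[C]_m => block_mx a 0 0 (1%:M : 'M[C]_n)).
Proof.
apply: matrix_continuous => i j.
case: (split_ordP i) => i' ->; case: (split_ordP j) => j' ->.
- rewrite (_ : (fun x => _) = (fun x : 'M[C]_m => x i' j')).
    exact: coord_continuous.
  by apply/funext => x; rewrite block_mxEul.
- rewrite (_ : (fun x => _) = cst (0 : C)); first exact: cst_continuous.
  by apply/funext => x; rewrite block_mxEur mxE.
- rewrite (_ : (fun x => _) = cst (0 : C)); first exact: cst_continuous.
  by apply/funext => x; rewrite block_mxEdl mxE.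
- rewrite (_ : (fun x => _) = cst ((1%:M : 'M[C]_n) i' j')).
    exact: cst_continuous.
  by apply/funext => x; rewrite block_mxEdr.
Qed.

Lemma matrix_compact_closed m n (A : set 'M[C]_(m, n)) : compact A -> closed A.
Proof. exact: compact_closed (@norm_hausdorff _ _). Qed.

Lemma closed_measurable d (A : set 'M[C]_d) :
  closed A -> measurable (A : set (borelM R d)).
Proof.
move=> Ac; rewrite -[A]setCK; apply: measurableC.
by apply: sub_sigma_algebra; apply: closed_openC.
Qed.

Lemma continuous_measurable d1 d2 (f : 'M[C]_d1 -> 'M[C]_d2) :
  continuous f -> measurable_fun setT (f : borelM R d1 -> borelM R d2).
Proof.
move=> fc; apply: (@measurability _ _ (borelM R d1) (borelM R d2) _ _ (@open 'M[C]_d2)) => //.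
move=> _ [A Ao <-].
rewrite setTI; apply: sub_sigma_algebra.
by move/continuousP: fc; apply.
Qed.

Lemma within_continuous_measurable d (U : set 'M[C]_d) (f : 'M[C]_d -> R) :
  closed U -> {within U, continuous f} ->
  measurable_fun (U : set (borelM R d)) f.
Proof.
move=> Uc /continuousP fc; apply: (measurability _ (RGenOpens.measurableE R)).
move=> _ [_ [a [b ->] <-]].
have /open_subspaceP[V Vo VE] := fc _ (@interval_open _ (BRight a) (BLeft b) isT isT).
rewrite setIC -VE; apply: measurableI; last exact: closed_measurable.
by apply: sub_sigma_algebra.
Qed.

End MatrixTopology.

(** * The sign character of B and -B *)

Section Sign.
Variables (R : realType) (d : nat).
Local Notation C := (CC R).

Definition signf (B : set 'M[C]_d) (x : 'M[C]_d) : R :=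
  \1_B x - \1_[set - a | a in B] x.

Lemma signf1 (B : set 'M[C]_d) x : B x -> ~ [set - a | a in B] x -> signf B x = 1.
Proof. by move=> Bx Nx; rewrite /signf !indicE (mem_set Bx) (memNset Nx) subr0. Qed.

Lemma signf_N1 (B : set 'M[C]_d) x : ~ B x -> [set - a | a in B] x -> signf B x = -1.
Proof. by move=> Bx Nx; rewrite /signf !indicE (mem_set Nx) (memNset Bx) sub0r. Qed.

Lemma opp_compact (B : set 'M[C]_d) : compact B -> compact [set - a | a in B].
Proof.
move=> Bc; apply: continuous_compact => //; apply: continuous_subspaceT.
by move=> x; exact: opp_continuous.
Qed.

(** Two disjoint compact sets are each open in their union, so the function is locally constant
    there. *)
Lemma signf_continuous (B : set 'M[C]_d) : compact B ->
  B `&` [set - a | a in B] = set0 ->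
  {within B `|` [set - a | a in B], continuous (signf B)}.
Proof.
move=> Bc BN0; set N := [set - a | a in B].
have Nc : compact N by apply: opp_compact.
have opB : open (~` B) by apply: closed_openC; apply: matrix_compact_closed.
have opN : open (~` N) by apply: closed_openC; apply: matrix_compact_closed.
have BN x : B x -> ~ N x by move=> Bx Nx; have : (B `&` N) x by []; rewrite BN0.
apply/subspace_continuousP => x [Bx|Nx]; apply: cvg_near_cst.
- have : \forall y \near x, ~ N y by apply: (open_nbhs_nbhs (conj opN (BN _ Bx))).
  apply: filterS => y Ny [By|//].
  by rewrite /from_subspace !signf1 //; apply: BN.
- have Bx : ~ B x by move=> /BN.
  have : \forall y \near x, ~ B y by apply: (open_nbhs_nbhs (conj opB Bx)).
  apply: filterS => y Ny [//|By].
  by rewrite /from_subspace !signf_N1.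
Qed.

(** Translation by -1 carries [B] to [-B], so both have the same Haar measure; these measures are
    the integrals of the positive and negative parts. *)
Lemma signf_integral (B U : set 'M[C]_d) (mu : probability (borelM R d) R) :
  haar U mu -> compact B -> U = B `|` [set - a | a in B] -> U (- 1%:M) ->
  B `&` [set - a | a in B] = set0 -> Rintegral mu U (signf B) = 0.
Proof.
move=> [_ inv] Bc UE UN1; set N := [set - a | a in B] => BN0.
have mB : measurable (B : set (borelM R d)).
  by apply: closed_measurable; apply: matrix_compact_closed.
have mN : measurable (N : set (borelM R d)).
  by apply: closed_measurable; apply: matrix_compact_closed; apply: opp_compact.
have mU : measurable (U : set (borelM R d)) by rewrite UE; apply: measurableU.
have muN : mu N = mu B.
  rewrite -(inv _ B UN1 mB); last by rewrite UE; left.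
  by congr (mu _); apply: eq_imagel => a _; rewrite mulNmx mul1mx.
have BN x : B x -> ~ N x by move=> Bx Nx; have : (B `&` N) x by []; rewrite BN0.
rewrite /Rintegral integralE.
have -> : (\int[mu]_(x in U) (fun x => (signf B x)%:E)^\+ x)%E = mu B.
  rewrite -[RHS](_ : (\int[mu]_(x in U) (\1_B x)%:E)%E = _); last first.
    by rewrite integral_indic // UE setIUr setIid [B `&` _]BN0 setU0.
  apply: eq_integral => x /set_mem; rewrite UE => -[Bx|Nx]; rewrite funeposE.
    by rewrite (signf1 Bx (BN _ Bx)) indicE (mem_set Bx) -EFin_max max_l.
  have Bx : ~ B x by move=> /BN.
  by rewrite (signf_N1 Bx Nx) indicE (memNset Bx) -EFin_max max_r.
have -> : (\int[mu]_(x in U) (fun x => (signf B x)%:E)^\- x)%E = mu N.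
  rewrite -[RHS](_ : (\int[mu]_(x in U) (\1_N x)%:E)%E = _); last first.
    by rewrite integral_indic // UE setIUr setIid [N `&` _]setIC BN0 set0U.
  apply: eq_integral => x /set_mem; rewrite UE => -[Bx|Nx]; rewrite funenegE.
    by rewrite (signf1 Bx (BN _ Bx)) indicE (memNset (BN _ Bx)) -EFin_max max_r // oppr_le0.
  have Bx : ~ B x by move=> /BN.
  by rewrite (signf_N1 Bx Nx) indicE (mem_set Nx) -EFinN opprK -EFin_max max_l.
rewrite muN subee //; exact: fin_num_measure.
Qed.

End Sign.

(** * Transport of Haar measure and equidistribution between compact groups *)

Section Transport.
Variables (R : realType) (K : fieldExtType rat) (iota : {rmorphism K -> algC}).
Local Notation C := (CC R).
Variables (d1 d2 : nat) (phi : 'M[C]_d1 -> 'M[C]_d2) (psi : 'M[C]_d2 -> 'M[C]_d1).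
Variables (U1 : set 'M[C]_d1) (U2 : set 'M[C]_d2).
Hypothesis phi_cont : continuous phi.
Hypotheses (phiU : forall a, U1 a -> U2 (phi a)) (psiU : forall b, U2 b -> U1 (psi b)).
Hypotheses (phiK : forall a, U1 a -> psi (phi a) = a)
           (psiK : forall b, U2 b -> phi (psi b) = b).
Hypothesis phiM : forall a b, U1 a -> U1 b -> phi (a *m b) = phi a *m phi b.
Hypothesis phi1 : phi 1%:M = 1%:M.
Hypotheses (U1_sub : is_subgroup U1) (U1_compact : compact U1) (U2_compact : compact U2).

(** [nu] is the image of [mu] under [phi]. The measures live on whole matrix spaces, while [phi] and
    [psi] are mutually inverse only between [U1] and [U2]; every set is therefore first cut down to
    [U1], which has full measure. *)
Lemma haar_transport (mu : probability (borelM R d1) R) : haar U1 mu ->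
  exists2 nu : probability (borelM R d2) R, haar U2 nu &
    forall f : 'M[C]_d2 -> R, {within U2, continuous f} ->
      Rintegral nu U2 f = Rintegral mu U1 (f \o phi).
Proof.
move=> [muU1 mu_inv].
have mphi := continuous_measurable phi_cont.
pose phim : {mfun borelM R d1 >-> borelM R d2} := mfun_Sub (mem_set mphi).
have mU1 : measurable (U1 : set (borelM R d1)).
  by apply: closed_measurable; apply: matrix_compact_closed.
have mU2 : measurable (U2 : set (borelM R d2)).
  by apply: closed_measurable; apply: matrix_compact_closed.
have mpre (A : set (borelM R d2)) : measurable A -> measurable (phi @^-1` A : set (borelM R d1)).
  by move=> mA; rewrite -[X in measurable X]setTI; apply: (mphi).
have muC : mu (~` U1) = 0%E by rewrite probability_setC // muU1 subee.
have mu0 (A : set (borelM R d1)) : measurable A -> A `<=` ~` U1 -> mu A = 0%E.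
  move=> mA AU; apply: (@subset_measure0 _ (borelM R d1) R mu A (~` U1)) => //.
  by apply: measurableC.
have muI (A : set (borelM R d1)) : measurable A -> mu A = mu (A `&` U1).
  move=> mA; rewrite (measureDI mu mA mU1) [X in (X + _)%E](_ : _ = 0%E) ?add0e //.
  by apply: mu0; [apply: measurableD|apply: subIsetr].
have mpreU2 := mpre _ mU2.
have U1pre : U1 `<=` phi @^-1` U2 by move=> a /phiU.
exists (distribution mu phim).
  split.
    apply: etrans (muI (phi @^-1` U2) mpreU2) _.
    by rewrite (_ : _ `&` U1 = U1) //; apply/setIidPr.
  move=> g A U2g mA AU2.
  have gu : phi (invmx (psi g)) *m g = 1%:M.
    have U1g := psiU U2g; have U1V := sg_V U1_sub U1g.
    rewrite -[X in _ *m X](psiK U2g) -phiM // mulVmx ?phi1 //.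
    exact: sg_unit U1_sub _ U1g.
  (* As a preimage under multiplication by the inverse of [g], the translate is visibly
     measurable. *)
  have gE : [set g *m a | a in A] = (fun a => phi (invmx (psi g)) *m a) @^-1` A.
    apply/seteqP; split=> [_ [a Aa <-] /=|b /= Ab].
      by rewrite mulmxA gu mul1mx.
    by exists (phi (invmx (psi g)) *m b) => //; rewrite mulmxA (mulmx1C gu) mul1mx.
  have mgA : measurable ([set g *m a | a in A] : set (borelM R d2)).
    rewrite gE -[X in measurable X]setTI.
    have mm := continuous_measurable (@continuous_mulmxl C d2 d2 (phi (invmx (psi g)))).
    exact: (mm measurableT A mA).
  apply: etrans (muI (phi @^-1` [set g *m a | a in A]) (mpre _ mgA)) _.
  apply: etrans (esym (muI (phi @^-1` A) (mpre _ mA))).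
  have mAU : measurable ((phi @^-1` A `&` U1) : set (borelM R d1)).
    by apply: measurableI => //; apply: mpre.
  rewrite -(mu_inv (psi g) _ (psiU U2g) mAU); last by move=> x [].
  congr (mu _); apply/seteqP; split=> [a [[b Ab bE] Ua]|_ [a [Aa Ua] <-]] /=.
    exists (psi b).
      by split; [rewrite /= psiK //; apply: AU2|apply: psiU; apply: AU2].
    rewrite -(phiK Ua) -bE -{2}(psiK U2g) -{2}(psiK (AU2 _ Ab)) -phiM ?phiK //.
    - by apply: (sg_M U1_sub); apply: psiU => //; apply: AU2.
    - exact: psiU.
    - by apply: psiU; apply: AU2.
  split; last by apply: (sg_M U1_sub) => //; apply: psiU.
  by exists (phi a) => //; rewrite phiM ?psiK //; apply: psiU.
move=> f fc; rewrite /Rintegral; congr fine.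
have mf := within_continuous_measurable (matrix_compact_closed U2_compact) fc.
pose fE : borelM R d2 -> \bar R := fun x => (f x)%:E.
have mF : measurable_fun (U2 : set (borelM R d2)) fE by exact/measurable_EFinP.
(* Change of variables for nonnegative functions, used below for the positive and the negative part
   of [f]. The preimage of [U2] may exceed [U1], but only by a null set. *)
have push (g : borelM R d2 -> \bar R) :
    measurable_fun (U2 : set (borelM R d2)) g -> (forall y, (0 <= g y)%E) ->
    (\int[distribution mu phim]_(y in U2) g y = \int[mu]_(x in U1) g (phi x))%E.
  move=> mg g0; rewrite ge0_integral_pushforward //.
  have mN : measurable ((phi @^-1` U2 `\` U1) : set (borelM R d1)) by exact: measurableD.
  rewrite (@ge0_negligible_integral _ (borelM R d1) R mu _ (phi @^-1` U2 `\` U1)) //.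
  - by rewrite setDD (_ : _ `&` U1 = U1) //; apply/setIidPr.
  - move=> _ Y mY.
    rewrite (_ : _ `&` _ = phi @^-1` (U2 `&` g @^-1` Y)) //.
    by apply: mpre; apply: mg.
  - by move=> x _; apply: g0.
  - exact: (mu0 _ mN (@subIsetr _ _ _)).
rewrite integralE [RHS]integralE; congr (_ - _)%E; 
  have mP : measurable_fun (U2 : set (borelM R d2)) fE^\+%E by apply: measurable_funepos.
  have P0 y : (0 <= fE^\+%E y)%E by [].
  by apply: etrans (push _ mP P0) _; apply: eq_integral => x _; rewrite !funeposE.
have mN : measurable_fun (U2 : set (borelM R d2)) fE^\-%E by apply: measurable_funeneg.
have N0 y : (0 <= fE^\-%E y)%E by [].
by apply: etrans (push _ mN N0) _; apply: eq_integral => x _; rewrite !funenegE.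
Qed.

Lemma equidistributed_transport (V : set (set K))
    (x1 : set K -> 'M[C]_d1) (x2 : set K -> 'M[C]_d2) :
  (forall v, V v -> x2 v = phi (x1 v)) ->
  equidistributed iota U1 V x1 -> equidistributed iota U2 V x2.
Proof.
move=> x12 [mu /haar_transport[nu hnu nuE] equi]; exists nu => // f fc fcl upto.
rewrite nuE //.
have fphic : {within U1, continuous (f \o phi)}.
  apply/subspace_continuousP => a Ua.
  have /subspace_continuousP/(_ _ (phiU Ua)) fa := fc.
  move=> A /fa /phi_cont; apply: (@filterS _ (nbhs a) (nbhs_filter a)) => x fA Ux; apply: fA.
  exact: phiU.
have fphicl g h : U1 g -> U1 h -> (f \o phi) (g *m h *m invmx g) = (f \o phi) h.
  move=> Ug Uh; have UV := sg_V U1_sub Ug.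
  rewrite /= !phiM //; last exact: (sg_M U1_sub).
  rewrite -[phi (invmx g)](@invmx_uniq _ _ (phi g)); last first.
    by rewrite -phiM // mulmxV ?phi1 // (sg_unit U1_sub).
  by apply: fcl; apply: phiU.
have -> : (fun m : nat => (\sum_(v \in upto m) f (x2 v)) / #|` fset_set (upto m)|%:R) =
  (fun m : nat => (\sum_(v \in upto m) (f \o phi) (x1 v)) / #|` fset_set (upto m)|%:R).
  apply/funext => m; congr (_ / _); apply: eq_fsbigr => v /set_mem[Vv _].
  by rewrite /= x12.
exact: equi.
Qed.
End Transport.
(** * The two Sato-Tate groups *)

Section SignedSubgroups.
Variables (R : realType) (d : nat) (H : set 'M[CC R]_d).
Hypothesis hH : is_subgroup H.
Local Notation pmH := (H `|` [set - a | a in H]).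

Lemma invmxN (a : 'M[CC R]_d) : a \in unitmx -> invmx (- a) = - invmx a.
Proof. by move=> au; apply: invmx_uniq; rewrite mulNmx mulmxN opprK mulmxV. Qed.

Lemma subgroup_N1 a : H a -> H (- a) -> H (- 1%:M).
Proof.
move=> Ha HNa; rewrite -(mulmxV (sg_unit hH Ha)) -mulNmx.
exact: (sg_M hH HNa (sg_V hH Ha)).
Qed.

Lemma subgroup_opp a : H (- 1%:M) -> H a -> H (- a).
Proof. by move=> HN1 Ha; rewrite -[a]mul1mx -mulNmx; apply: (sg_M hH). Qed.

Lemma pm_subgroupE : H (- 1%:M) -> pmH = H.
Proof.
move=> HN1; apply/seteqP; split=> [a [//|[b Hb <-]]|a Ha]; last by left.
exact: subgroup_opp.
Qed.

(** The two signs cancel in a conjugation, so [H] is normalized by its negatives as well. *)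
Lemma pm_conj g h : pmH g -> H h -> H (g *m h *m invmx g).
Proof.
move=> + Hh; case=> [Hg|[g' Hg <-]].
  by apply: (sg_M hH); [apply: (sg_M hH)|apply: (sg_V hH)].
rewrite invmxN ?(sg_unit hH Hg) // mulmxN !mulNmx opprK.
by apply: (sg_M hH); [apply: (sg_M hH)|apply: (sg_V hH)].
Qed.

Lemma trivial_quotient_pm : trivial_quotient pmH H <-> H (- 1%:M).
Proof.
have H1 := sg_1 hH; split=> [tq|HN1].
  have : cosets pmH H [set (- 1%:M) *m b | b in H].
    by exists (- 1%:M) => //; right; exists 1%:M.
  by rewrite tq => <-; exists 1%:M => //; rewrite mulmx1.
rewrite /trivial_quotient pm_subgroupE //; apply/seteqP; split=> [_ [a Ha <-]|_ ->].
  apply/seteqP; split=> [_ [b Hb <-]|b Hb]; first exact: (sg_M hH Ha Hb).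
  exists (invmx a *m b); first exact: (sg_M hH (sg_V hH Ha) Hb).
  by rewrite mulmxA mulmxV ?mul1mx // (sg_unit hH Ha).
exists 1%:M => //; apply/seteqP; split=> [_ [b Hb <-]|b Hb]; first by rewrite mul1mx.
by exists b => //; rewrite mul1mx.
Qed.

Lemma pm_disjoint : ~ H (- 1%:M) -> H `&` [set - a | a in H] = set0.
Proof.
move=> HN1; apply/seteqP; split=> [a [Ha [b Hb ba]]|//]; apply: HN1.
by apply: (subgroup_N1 (a := b)) => //; rewrite ba.
Qed.

Lemma signf_class g h : ~ H (- 1%:M) -> pmH g -> pmH h ->
  signf H (g *m h *m invmx g) = signf H h.
Proof.
move=> /pm_disjoint HN pg.
have notN a : H a -> ~ [set - a | a in H] a.
  by move=> Ha Na; have : (H `&` [set - a | a in H]) a by []; rewrite HN.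
case=> [Hh|[h' Hh <-]].
  have Hc := pm_conj pg Hh.
  by rewrite (signf1 Hc (notN _ Hc)) (signf1 Hh (notN _ Hh)).
have Nc : [set - a | a in H] (g *m (- h') *m invmx g).
  by exists (g *m h' *m invmx g); [exact: pm_conj|rewrite mulmxN mulNmx].
have Nh : [set - a | a in H] (- h') by exists h'.
by rewrite (signf_N1 _ Nc) ?(signf_N1 _ Nh) // => /notN; apply.
Qed.
End SignedSubgroups.

(* The Haar mean of signf is 0. Finiteness of the residue fields ensures that the
   means are eventually taken over finite nonempty sets of primes. *)
Lemma not_equidistributed_index2 (R : realType) (K : fieldExtType rat)
    (iota : {rmorphism K -> algC}) (d : nat) (B U : set 'M[CC R]_d)
    (S : set (set K)) (x : set K -> 'M[CC R]_d) :
  is_subgroup B -> compact B -> U = B `|` [set - a | a in B] -> ~ B (- 1%:M) ->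
  finite_set S ->
  (forall v, primeK iota v -> ~ S v -> residue_card iota v != 0%N /\ B (x v)) ->
  ~ equidistributed iota U (primeK iota `\` S) x.
Proof.
move=> hB Bc UE BN1 Sf xB [mu hmu equi].
have UN1 : U (- 1%:M) by rewrite UE; right; exists 1%:M => //; exact: (sg_1 hB).
have fc : {within U, continuous (signf B)}.
  by rewrite UE; apply: signf_continuous => //; exact: pm_disjoint.
have fcl g h : U g -> U h -> signf B (g *m h *m invmx g) = signf B h.
  by rewrite UE => Ug Uh; exact: signf_class.
have := equi _ fc fcl; rewrite (signf_integral hmu Bc UE UN1) ?pm_disjoint //.
set upto := fun m : nat => _; rewrite /=.
have uptof m : finite_set (upto m).
  apply: (sub_finite_set _ (finite_residue_card_le iota m)) => v [[vP vS] vm].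
  by have [v0 _] := xB v vP vS; split.
have [v0 v0P v0S] := exists_primeK_notin iota Sf.
have mean1 m : (residue_card iota v0 <= m)%N ->
    (\sum_(v \in upto m) signf B (x v)) / #|` fset_set (upto m)|%:R = 1.
  move=> m0.
  have -> : \sum_(v \in upto m) signf B (x v) = #|` fset_set (upto m)|%:R.
    rewrite fsbig_finite //.
    rewrite big_seq (eq_bigr (fun _ => 1)) => [|v].
      by rewrite -big_seq big_const_seq count_predT iter_addr_0.
    rewrite in_fset_set // => /set_mem[[vP vS] _]; have [_ Bx] := xB v vP vS.
    apply: signf1 => // Nx.
    have : (B `&` [set - a | a in B]) (x v) by [].
    by rewrite pm_disjoint.
  rewrite divff // pnatr_eq0 cardfs_eq0; apply/eqP => upto0.
  have v0m : upto m v0 by split.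
  have : v0 \in fset_set (upto m) by rewrite (in_fset_set (uptof m)); apply: mem_set.
  by rewrite upto0 inE.
move=> lim0.
have lim1 : (fun m : nat => (\sum_(v \in upto m) signf B (x v)) /
    #|` fset_set (upto m)|%:R) @ \oo --> (1 : R).
  by apply: cvg_near_cst; exists (residue_card iota v0) => // m /= m0; exact: mean1.
have /eqP : (0 : R) = 1 by apply: (cvg_unique (@norm_hausdorff _ R) lim0 lim1).
by rewrite eq_sym oner_eq0.
Qed.

(** * Comparison of the two groups and of their Frobenius classes *)

Section AlgebraicSatoTateGroups.
Variables (R : realType) (K : fieldExtType rat) (iota : {rmorphism K -> algC}).
Variable jC : {rmorphism algC -> CC R}.
Variable Ql : forall l : nat, prime l -> padicField R l.
Variables (Mo : motives iota jC Ql) (M MT : Mo).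
Hypothesis MT_sum : direct_sum MT M (tate Mo).
Local Notation C := (CC R).
Local Notation dM := (bdim (betti Mo) M).
Local Notation dT := (bdim (betti Mo) (tate Mo)).

Lemma tembed1 : tembed (1%:M : 'M[C]_dM) = 1%:M.
Proof. exact: block_diag1. Qed.

Lemma tAST_unit a : tAST M MT (tembed a) -> a \in unitmx.
Proof.
have [GM _] := generated_summand MT_sum.
by move=> /tASTP[g [[gu _ _ _] <- _]]; apply: gu.
Qed.

Lemma tembedV a : a \in unitmx -> tembed (invmx a) = invmx (tembed a : 'M[C]_(dM + dT)).
Proof. by move=> au; apply/esym/invmx_uniq; rewrite -tembedM mulmxV ?tembed1. Qed.

Lemma projV_subgroup (A : set 'M[C]_(dM + dT)) : A `<=` tAST M MT ->
  is_subgroup A -> is_subgroup (projV A).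
Proof.
move=> AS hA; split.
- by move=> a /(projV_tembed _ AS)/AS/tAST_unit.
- by apply/(projV_tembed _ AS); rewrite tembed1; apply: (sg_1 hA).
- move=> a b /(projV_tembed _ AS) Aa /(projV_tembed _ AS) Ab.
  by apply/(projV_tembed _ AS); rewrite tembedM; apply: (sg_M hA).
- move=> a /(projV_tembed _ AS) Aa; apply/(projV_tembed _ AS).
  by rewrite tembedV; [apply: (sg_V hA)|apply: tAST_unit (AS _ Aa)].
Qed.

Lemma continuous_tembed : continuous (@tembed R K iota jC Ql Mo M).
Proof. exact: continuous_block_diag1. Qed.

Variables (n : int) (l : nat) (pl : prime l) (e : {rmorphism Ql pl -> C}).

Lemma frobenius_tate (v : set K) (sigma : absGal iota) :
  frobenius v sigma -> ~ v l%:R ->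
  et (metale Mo) pl (tate Mo) sigma = ((residue_card iota v)%:R)%:M.
Proof.
move=> Fs vl; have [chi chiP ->] := tate_etale Mo pl.
by rewrite (cyclotomic_frobenius pl chiP Fs vl).
Qed.

(** The factor 1 / q_v cancels the cyclotomic character, so the normalised Frobenius is already the
    identity on the Tate block, and semisimple parts are computed blockwise. *)
Lemma frob_ts_tembed (v : set K) (s : 'M[C]_dM) : ~ v l%:R ->
  frob_ts M n e v (tembed s) <-> frob_s M n e v s.
Proof.
move=> vl.
have blockE sigma : frobenius v sigma ->
    diag_block (qhalf R iota n v *: map_mx e (et (metale Mo) pl M sigma))
      (qinv R iota v *: map_mx e (et (metale Mo) pl (tate Mo) sigma)) =
    tembed (qhalf R iota n v *: map_mx e (et (metale Mo) pl M sigma)).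
  move=> Fs; rewrite /diag_block /tembed (frobenius_tate Fs vl); congr block_mx.
  rewrite map_scalar_mx rmorph_nat scale_scalar_mx /qinv mulVf //.
  by rewrite pnatr_eq0 (frobenius_residue_card Fs pl vl).
split=> -[sigma Fs ss]; exists sigma => //.
  by move: ss; rewrite blockE //; apply: semisimple_part_block_inv.
by rewrite blockE //; apply: semisimple_part_block => //; apply: semisimple_part_scalar.
Qed.

Lemma frob_s_projV (v : set K) (s : 'M[C]_dM) :
  weight_proj (mhodge Mo) M n = 1%:M -> ~ v l%:R -> frob_s M n e v s ->
  residue_card iota v != 0%N /\ projV (tAST M MT) s.
Proof.
move=> Mn vl [sigma Fs ss]; have v0 := frobenius_residue_card Fs pl vl.
split=> //; have v1 : (0 < residue_card iota v)%N by rewrite lt0n.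
apply: (proj2 (projV_tembed (MT := MT) s (fun x h => h))).
exact: (frobenius_projV MT_sum Mn v1 (frobenius_tate Fs vl) ss).
Qed.

End AlgebraicSatoTateGroups.

Theorem theorem17p15
  (R : realType) (K : fieldExtType rat) (iota : {rmorphism K -> algC})
  (jC : {rmorphism algC -> CC R})
  (Ql : forall l : nat, prime l -> padicField R l)
  (Mo : motives iota jC Ql)
  (A1 : kunneth Mo) (A2 : tannakian_semisimple Mo) (A3 : star_operators A1)
  (A4 : artin_hom Mo)
  (M : Mo) (n : int) (M_homogeneous : homogeneous A1 M n) (n_neq0 : n != 0)
  (psi : mor (tens M M) (unit_twist Mo (- n)))
  (psi_polarization : polarization psi)
  (M_compatible : strictly_compatible M)
  (MT : Mo) (MT_sum : direct_sum MT M (tate Mo))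
  (AST_pm : AST psi = pm_union (projV (tAST M MT)))
  (ST : set 'M[CC R]_(bdim (betti Mo) M))
  (tST : set 'M[CC R]_(bdim (betti Mo) M + bdim (betti Mo) (tate Mo)))
  (ST_max : maximal_compact (AST psi) ST)
  (tST_max : maximal_compact (tAST M MT) tST)
  (ST_pm : ST = pm_union (projV tST))
  (l : nat) (pl : prime l) (e : {rmorphism Ql l pl -> CC R})
  (S : set (set K)) (S_finite : finite_set S)
  (S_l : forall v, primeK iota v -> v l%:R -> S v)
  (S_unramified : forall v, primeK iota v -> ~ S v ->
     unramified (et (metale Mo) pl M) v) :
  let P_ST_trivial := trivial_quotient (AST psi) (projV (tAST M MT)) in
  let ST_conjecture := sato_tate iota (AST psi) ST (frob_s M n e) S in
  let tST_conjecture :=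
    sato_tate iota (tAST M MT) tST (frob_ts M n e) S in
  [/\ P_ST_trivial <-> trivial_quotient ST (projV tST),
      P_ST_trivial <-> projV tST (- 1%:M),
      ~ P_ST_trivial -> ~ ST_conjecture &
      P_ST_trivial -> (ST_conjecture <-> tST_conjecture)].
Proof.
move=> P_ST_trivial ST_conjecture tST_conjecture.
have Mn : weight_proj (mhodge Mo) M n = 1%:M by case: psi_polarization.
have hG := tAST_subgroup MT_sum.
have [[tSTG htST tSTc] tSTmax] := tST_max.
have [[STA hST STc] _] := ST_max.
set GV := projV (tAST M MT); set B := projV tST.
have GVP a : GV a <-> tAST M MT (tembed a) := projV_tembed a (fun b Gb => Gb).
have BP a : B a <-> tST (tembed a) := projV_tembed a tSTG.
have hGV : is_subgroup GV by apply: (projV_subgroup MT_sum).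
have hB : is_subgroup B := projV_subgroup MT_sum tSTG htST.
have BG : B `<=` GV by move=> a /BP /tSTG /GVP.
have tSTE b : tST b -> b = tembed (ulsubmx b) by move=> /tSTG /tAST_tembed.
have ASTE : GV (- 1%:M) -> AST psi = GV.
  by move=> GN1; rewrite AST_pm; apply: (pm_subgroupE hGV).
have P1 : P_ST_trivial <-> GV (- 1%:M).
  by rewrite /P_ST_trivial AST_pm; apply: (trivial_quotient_pm hGV).
have P2 : GV (- 1%:M) <-> B (- 1%:M).
  split=> [GN1|/BG //].
  have STGV : ST `<=` GV by rewrite -(ASTE GN1).
  have B1 := sg_1 hB.
  (* By maximality, tST is the image of ST. *)
  pose U := ([set tembed a | a in ST] : set 'M[CC R]_(bdim (betti Mo) M + bdim (betti Mo) (tate Mo))).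
  have UtST : U = tST.
    apply: tSTmax.
      split.
      - by move=> _ [a /STGV/GVP Ga <-].
      - split.
        + by move=> _ [a STa <-]; apply: (sg_unit hG); apply/GVP/STGV.
        + by exists 1%:M; [exact: (sg_1 hST)|exact: tembed1].
        + move=> _ _ [a STa <-] [b STb <-]; exists (a *m b); last exact: tembedM.
          exact: (sg_M hST).
        + move=> _ [a STa <-]; exists (invmx a); first exact: (sg_V hST).
          by rewrite tembedV // (sg_unit hST).
      - apply: continuous_compact => //.
        by apply: continuous_subspaceT; apply: continuous_tembed.
    move=> b tb; exists (ulsubmx b); last by rewrite -(tSTE _ tb).
    by rewrite ST_pm; left; apply/BP; rewrite -(tSTE _ tb).
  apply/BP; rewrite -UtST; exists (- 1%:M) => //.
  by rewrite ST_pm; right; exists 1%:M.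
have P3 : trivial_quotient ST B <-> B (- 1%:M).
  by rewrite ST_pm; apply: (trivial_quotient_pm hB).
have lS v : primeK iota v -> ~ S v -> ~ v l%:R by move=> vP vS /S_l; auto.
split.
- by split=> [/P1/P2/P3|/P3/P2/P1].
- by split=> [/P1/P2|/P2/P1].
- move=> nP [x xP].
  have nGV : ~ GV (- 1%:M) by move=> /P1.
  have Bc : compact B.
    apply: continuous_compact => //.
    by apply: continuous_subspaceT; apply: continuous_ulsubmx.
  apply: (not_equidistributed_index2 (B := B)) => // [/BG //|v vP vS].
  have [STx [s [g [fs Ag xE]]]] := xP v vP vS.
  have [v0 Gs] := frob_s_projV MT_sum Mn (lS v vP vS) fs.
  (* [x v] is conjugate to [s] only under [AST], but the elements of [AST] are those of [GV] up to
     sign and normalize it. *)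
  have Gx : GV (x v).
    by rewrite xE; apply: pm_conj => //; move: Ag; rewrite AST_pm.
  (* If [x v] were in [-B], both [b] and [-b] would lie in [GV], and -1 with them. *)
  split=> //; move: STx; rewrite ST_pm => -[//|[b Bb bx]].
  exfalso; apply: nGV; apply: (subgroup_N1 hGV (BG _ Bb)).
  by rewrite bx.
move=> /P1 GN1; have /P2 BN1 := GN1.
have {}ASTE := ASTE GN1.
have STE : ST = B by rewrite ST_pm; apply: (pm_subgroupE hB).
have tembedK a : ulsubmx (tembed a : 'M[CC R]_(_ + bdim (betti Mo) (tate Mo))) = a.
  by rewrite /tembed block_mxKul.
split=> -[x xP equi].
- exists (fun v => tembed (x v)).
    move=> v vP vS; have [STx [s [g [fs Ag xE]]]] := xP v vP vS.
    split; first by apply/BP; rewrite -STE.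
    exists (tembed s), (tembed g); split.
    + by apply/(frob_ts_tembed _ _ _ (lS v vP vS)).
    + by apply/GVP; rewrite -/GV -ASTE.
    + rewrite xE !tembedM tembedV //.
      by apply: (sg_unit hGV); rewrite -ASTE.
  apply: (equidistributed_transport (phi := fun a => tembed a) (psi := ulsubmx)) equi => //.
  + exact: continuous_tembed.
  + by move=> a; rewrite STE => /BP.
  + by move=> b tb; rewrite STE; apply/BP; rewrite -(tSTE _ tb).
  + by move=> b /tSTE.
  + by move=> a b _ _; exact: tembedM.
  + exact: tembed1.
- exists (fun v => ulsubmx (x v)).
    move=> v vP vS; have [tSTx [s [g [fs Ag xE]]]] := xP v vP vS.
    set g' := ulsubmx g; set x' := ulsubmx (x v).
    have Eg : g = tembed g' := tAST_tembed Ag.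
    have Ex : x v = tembed x' := tSTE _ tSTx.
    have GVg : GV g' by apply/GVP; rewrite -Eg.
    have gu := sg_unit hGV GVg.
    (* Membership of [s] in [tAST] is not given; undoing the conjugation shows that it has the block
       form required by [frob_ts_tembed]. *)
    have Es : s = tembed (invmx g' *m x' *m g').
      have gu' := sg_unit hG Ag.
      rewrite !tembedM tembedV // -Eg -Ex xE !mulmxA mulVmx // mul1mx.
      by rewrite -mulmxA mulVmx ?mulmx1.
    split; first by rewrite STE; apply/BP; rewrite -Ex.
    exists (invmx g' *m x' *m g'), g'; split.
    + by apply/(frob_ts_tembed _ _ _ (lS v vP vS)); rewrite -Es.
    + by rewrite ASTE.
    + by rewrite !mulmxA mulmxV // mul1mx mulmxK.
  apply: (equidistributed_transport (phi := ulsubmx) (psi := fun a => tembed a)) equi => //.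
  + exact: continuous_ulsubmx.
  + by move=> b tb; rewrite STE; apply/BP; rewrite -(tSTE _ tb).
  + by move=> a; rewrite STE => /BP.
  + by move=> b /tSTE.
  + by move=> a b ta tb; rewrite [in LHS](tSTE _ ta) [in LHS](tSTE _ tb) -tembedM tembedK.
  + by rewrite -tembed1 tembedK.
Qed.
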